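(* Let $n\ge 2$, let $\lambda>0$ be real and let $M\ge 0$ be an integer. If $f:\mathbb{R}^{n-1}\to\mathbb{R}$ is measurable and $$\int_{\mathbb{R}^{n-1}}\frac{|f(y')|\,dy'}{|y'|^{M+2\lambda}+1}<\infty, \qquad ( * )$$ then $$F_{\lambda,M}[f](x)=o\left(|x|^{M}\sec^{2\lambda}\theta\right)\qquad (x\in\Pi_+,\ |x|\to\infty).$$ Moreover this order relation is sharp, i.e. $\omega(x)=|x|^M\sec^{2\lambda}\theta$ is a sharp growth condition for $F_{\lambda,M}$: in addition to the estimate above, for every function $\psi:\Pi_+\to(0,\infty)$ with $\psi(x)=o(|x|^M\sec^{2\lambda}\theta)$ ($x\in\Pi_+$, $|x|\to\infty$) and every sequence $\{x^{(i)}\}$ in $\Pi_+$ with $|x^{(i)}|\to\infty$, there exists a continuous function $f:\mathbb{R}^{n-1}\to\mathbb{R}$ satisfying $( * )$ such that $F_{\lambda,M}[f](x^{(i)})/\psi(x^{(i)})\not\to 0$ as $i\to\infty$.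
   Context: Half space: $\Pi_+=\{x\in\mathbb{R}^n: x_n>0\}$. For $x\in\Pi_+$ let $y\in\mathbb{R}^{n-1}$ be the projection of $x$ onto $\partial\Pi_+$ (identified with $\mathbb{R}^{n-1}$), and let $\theta\in[0,\pi/2)$ be the angle between $x$ and the unit normal $\hat e_n$, so $x_n=|x|\cos\theta$, $|y|=|x|\sin\theta$. For $y'\in\mathbb{R}^{n-1}$, $\theta'\in[0,\pi]$ is the angle between $y$ and $y'$, so $y\cdot y'=|y'||x|\sin\theta\cos\theta'$ (with $\theta'=\pi/2$ if $y=0$ or $y'=0$; when $n=2$, $\cos\theta'=\operatorname{sgn}(x_1y')$). Kernels: $K(\lambda,x,y')=\left[|y'-y|^2+x_n^2\right]^{-\lambda}$, and for $|y'|>0$ $$K_M(\lambda,x,y')=K(\lambda,x,y')-\sum_{m=0}^{M-1}\frac{|x|^m}{|y'|^{m+2\lambda}}C_m^\lambda(\sin\theta\cos\theta'),\qquad K_0=K,$$ where $C_m^\lambda$ are the Gegenbauer polynomials, defined by $(1-2tz+z^2)^{-\lambda}=\sum_{m\ge0}z^mC_m^\lambda(t)$. Define $$F_{\lambda,M}[f](x)=\int_{|y'|>1}f(y')K_M(\lambda,x,y')\,dy'.$$ Order relations: $g(x)=o(\omega(x))$ ($x\in\Pi_+$, $|x|\to\infty$) means $g(x)/\omega(x)\to0$ as $|x|\to\infty$ uniformly over $x\in\Pi_+$, i.e. $\sup\{|g(x)|/\omega(x):x\in\Pi_+,|x|=r\}\to0$ as $r\to\infty$. *)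

(* Defs.v *)
From HB Require Import structures.
From mathcomp Require Import all_boot all_order all_algebra.
From mathcomp Require Import all_classical all_reals all_analysis.

Set Implicit Arguments.
Unset Strict Implicit.
Unset Printing Implicit Defensive.

Import Order.TTheory GRing.Theory Num.Theory.
Import numFieldNormedType.Exports.
Local Open Scope classical_set_scope.
Local Open Scope ring_scope.

(* The sigma-algebra generated by the coordinate maps, i.e. the Borel one. *)
Definition rV_display : measure_display. Proof. exact. Qed.

Section measurable_rV.
Context {R : realType} (n : nat).

Let coord : 'I_n -> 'rV[R]_n -> measurableTypeR R := fun i v => v 0 i.

Let rV_set0 : g_sigma_preimage coord set0.
Proof. exact: sigma_algebra0. Qed.

Let rV_setC A : g_sigma_preimage coord A -> g_sigma_preimage coord (~` A).
Proof. exact: sigma_algebraC. Qed.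

Let rV_bigcup (F : _^nat) : (forall i, g_sigma_preimage coord (F i)) ->
  g_sigma_preimage coord (\bigcup_i (F i)).
Proof. exact: sigma_algebra_bigcup. Qed.

HB.instance Definition _ := @isMeasurable.Build rV_display
  'rV[R]_n (g_sigma_preimage coord) rV_set0 rV_setC rV_bigcup.

Lemma measurable_coord (i : 'I_n) :
  measurable_fun [set: 'rV[R]_n] (fun v => v 0 i : measurableTypeR R).
Proof.
move=> _ Y mY; rewrite setTI; apply: sub_sigma_algebra => /=.
rewrite -bigcup_seq/=; exists i => /=; first by rewrite mem_index_enum.
by exists Y => //; rewrite setTI.
Qed.

Lemma measurable_fun_rVP d (T : measurableType d) (f : T -> 'rV[R]_n) :
  (forall i, measurable_fun [set: T] (fun t => f t 0 i : measurableTypeR R)) ->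
  measurable_fun [set: T] f.
Proof.
move=> mf _ A mA; rewrite setTI.
suff: preimage_set_system setT f (@measurable _ 'rV[R]_n) `<=` measurable.
  by apply; exists A => //; rewrite setTI.
rewrite -[X in preimage_set_system _ _ X]/(g_sigma_preimage coord).
rewrite -g_sigma_preimage_comp; apply: smallest_sub.
  exact: sigma_algebra_measurable.
rewrite -bigcup_seq/=; apply: bigcup_sub => i _ _ [B mB <-].
exact: mf.
Qed.

End measurable_rV.

Section lebesgue_rV.
Context {R : realType}.

Definition rV_rcons n (p : 'rV[R]_n * measurableTypeR R) : 'rV[R]_n.+1 :=
  \row_i (if unlift ord_max i is Some j then p.1 0 j else p.2).

Lemma measurable_rV_rcons n : measurable_fun setT (@rV_rcons n).
Proof.
apply: measurable_fun_rVP => i; rewrite /rV_rcons.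
under eq_fun do rewrite mxE.
case: unliftP => [j _|_]; last exact: measurable_snd.
exact: measurableT_comp (measurable_coord j) measurable_fst.
Qed.

Section step.
Variables (n : nat) (mu : {measure set 'rV[R]_n -> \bar R}).

Definition lebesgue_rV_step : set 'rV[R]_n.+1 -> \bar R :=
  pushforward (mu \x @lebesgue_measure R)%E (@rV_rcons n).

(* The measure structure of [pushforward] takes the measurability proof as an
   extra argument, so it is not inferred and has to be supplied here. *)
Let image_measure : {measure set 'rV[R]_n.+1 -> \bar R} :=
  measure_function_pushforward__canonical__measure_function_Measure
    (mu \x @lebesgue_measure R)%E (@measurable_rV_rcons n).

Let step0 : lebesgue_rV_step set0 = 0%E.
Proof. exact: (measure0 image_measure). Qed.

Let step_ge0 A : (0 <= lebesgue_rV_step A)%E.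
Proof. exact: (measure_ge0 image_measure). Qed.

Let step_sigma_additive : semi_sigma_additive lebesgue_rV_step.
Proof. exact: (@measure_semi_sigma_additive _ _ _ image_measure). Qed.

HB.instance Definition _ := isMeasure.Build _ _ _ lebesgue_rV_step
  step0 step_ge0 step_sigma_additive.

End step.

(* Lebesgue measure restricted to the Borel sets, as an iterated product. *)
Fixpoint borel_lebesgue_rV (n : nat) : {measure set 'rV[R]_n -> \bar R} :=
  if n is m.+1 then lebesgue_rV_step (borel_lebesgue_rV m)
  else dirac (0 : 'rV[R]_0).

Lemma borel_lebesgue_rV_box n (A : 'I_n -> set (measurableTypeR R)) :
  (forall i, measurable (A i)) ->
  borel_lebesgue_rV n [set v | forall i, A i (v 0 i)] =
  (\prod_(i < n) lebesgue_measure (A i))%E.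
Proof.
elim: n A => [|n IHn] A mA.
  by rewrite big_ord0 /= diracE mem_set// => -[].
have mbox m (B : 'I_m -> set (measurableTypeR R)) :
    (forall i, measurable (B i)) ->
    measurable ([set v | forall i, B i (v 0 i)] : set 'rV[R]_m).
  move=> mB.
  rewrite (_ : [set v | _] = \bigcap_(i in [set: 'I_m]) [set v | B i (v 0 i)]).
    apply: fin_bigcap_measurable => // i _.
    by rewrite -[X in measurable X]setTI; exact: measurable_coord.
  by apply/seteqP; split=> v /= h i; [move=> _; exact: h|exact: h].
pose B i := A (widen_ord (leqnSn n) i).
have mB i : measurable (B i) by exact: mA.
rewrite big_ord_recr /= -(IHn B mB).
rewrite -(product_measure1E _ _ (mbox _ _ mB) (mA ord_max)).
rewrite /lebesgue_rV_step /pushforward; congr (_ _).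
apply/seteqP; split=> -[v t] /=.
  move=> h; split=> [i|].
    have := h (lift ord_max i); rewrite mxE liftK /=.
    by congr (A _ _); apply: val_inj; rewrite /= /bump leqNgt ltn_ord.
  by have := h ord_max; rewrite mxE unlift_none.
move=> [hv ht] i; rewrite mxE; case: unliftP => [j|] -> //=.
have := hv j; congr (A _ _).
by apply: val_inj; rewrite /= /bump leqNgt ltn_ord.
Qed.

(* [lebesgue_rV n] is the complete Lebesgue measure on R^n; [measurable] on its
   carrier [lebesgue_type n] (an alias of ['rV_n]) is Lebesgue measurability. *)
Definition lebesgue_type (n : nat) : measurableType _ :=
  caratheodory_type ((borel_lebesgue_rV n)^*)%mu.

Definition lebesgue_rV (n : nat) :
    {measure set (lebesgue_type n) -> \bar R} :=
  @completed_measure_extension _ _ _ (borel_lebesgue_rV n).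

End lebesgue_rV.

Arguments lebesgue_type : clear implicits.

(* The library's norm on matrices is the maximum norm. *)
Section euclidean.
Context {R : realType}.

Definition dot n (u v : 'rV[R]_n) : R := \sum_(i < n) u 0 i * v 0 i.

Definition enorm n (u : 'rV[R]_n) : R := Num.sqrt (dot u u).

(* If [u] or [v] is zero, this is [acos 0 = pi / 2]. *)
Definition angle n (u v : 'rV[R]_n) : R :=
  acos (dot u v / (enorm u * enorm v)).

End euclidean.

(* Throughout, [d] is n - 1: the half space lies in R^(d + 1), its boundary is
   identified with R^d, and the distinguished coordinate is the last one. *)
Section half_space.
Context {R : realType} (d : nat).

Definition half_space : set 'rV[R]_d.+1 := [set x | 0 < x 0 ord_max].

Definition proj (x : 'rV[R]_d.+1) : 'rV[R]_d :=
  \row_(i < d) x 0 (widen_ord (leqnSn d) i).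

Definition theta (x : 'rV[R]_d.+1) : R := angle x (delta_mx 0 ord_max).

Definition theta' (x : 'rV[R]_d.+1) (y' : 'rV[R]_d) : R := angle (proj x) y'.

Definition little_o (g : 'rV[R]_d.+1 -> \bar R) (w : 'rV[R]_d.+1 -> R) : Prop :=
  ereal_sup [set (`|g x| * ((w x)^-1)%:E)%E | x in
    [set x | half_space x /\ enorm x = r]] @[r --> +oo%R] --> 0%E.

End half_space.

Section kernel.
Context {R : realType} (lambda : R).

(* A power series is determined by its sum near 0 and a polynomial over R by its
   values, so at most one sequence satisfies this. *)
Definition gegenbauer_gf (C : nat -> {poly R}) : Prop :=
  forall t : R, \forall z \near (0 : R),
    series (fun m => z ^+ m * (C m).[t]) @ \oo -->
      (1 - 2 * t * z + z ^+ 2) `^ (- lambda).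

Definition gegenbauer : nat -> {poly R} := xget (fun=> 0) gegenbauer_gf.

Section dim.
Context (d : nat).
Implicit Types (x : 'rV[R]_d.+1) (f : 'rV[R]_d -> R).

Definition K x (y' : 'rV[R]_d) : R :=
  (enorm (y' - proj x) ^+ 2 + x 0 ord_max ^+ 2) `^ (- lambda).

Definition KM (M : nat) x (y' : 'rV[R]_d) : R :=
  K x y' - \sum_(m < M) enorm x ^+ m / enorm y' `^ (m%:R + 2 * lambda) *
             (gegenbauer m).[sin (theta x) * cos (theta' x y')].

(* The extended real-valued integral, so that a divergent one is not
   silently replaced by 0. *)
Definition F (M : nat) f x : \bar R :=
  (\int[lebesgue_rV d]_(y' in [set y' | (1 < enorm y')%R])
     (f y' * KM M x y')%:E)%E.

Definition growth_integrable (M : nat) f : Prop :=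
  (\int[lebesgue_rV d]_y'
     (`|f y'| / (enorm y' `^ (M%:R + 2 * lambda) + 1))%:E < +oo)%E.

Definition omega (M : nat) x : R :=
  enorm x ^+ M * (cos (theta x))^-1 `^ (2 * lambda).

End dim.
End kernel.

(* Main.v *)
Require Import Defs.
From mathcomp Require Import all_boot all_order all_algebra.
From mathcomp Require Import all_classical all_reals all_analysis.
From mathcomp Require Import measurable_realfun ring lra.
Import Order.TTheory GRing.Theory Num.Theory.
Import numFieldNormedType.Exports.
Local Open Scope classical_set_scope.
Local Open Scope ring_scope.

Set Implicit Arguments.
Unset Strict Implicit.
Unset Printing Implicit Defensive.

(** Write [u = |x| / |y|], [t] for the cosine of the angle between [y] and the
    projection of [x] times [sin (theta x)], and [p = M + 2 lambda]. Homogeneity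
    gives [KM x y = |y| ^ (- 2 lambda) * h u t], where [h u t] is
    [(1 - 2 t u + u^2) ^ (- lambda)] minus its Taylor polynomial of degree below
    [M] in [u] (lemma [KM_E]). Both halves of the theorem come from comparing
    [KM x y] with [omega x * |y| ^ (- p)].

    Upper bound ([KM_le]). For small [u] the Taylor remainder is [O(u ^ M)],
    uniformly in [|t| <= 1], which is [O(omega x * |y| ^ (- p))] because the
    secant is at least 1. For the other [u] the distance from [x] to the
    boundary bounds [K] by [|x| ^ (- 2 lambda) sec ^ (2 lambda)], and the
    subtracted terms are bounded separately; here a power of [1 + u] is gained.
    So [KM x y / (omega x * |y| ^ (- p))] is bounded and tends to 0, uniformly
    on the half sphere [|x| = r], as [r] goes to infinity with [y] fixed.
    Dominated convergence against the integrable weight then gives the estimate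
    ([F_little_o]).

    Sharpness. The upper bound is attained up to a constant: for every [x] with
    [|x| > 2] some [y] with [|y| >= |x| / 2] satisfies
    [|KM x y| >= c * omega x * |y| ^ (- p)] ([KM_ge]). If [x_n] is small
    compared with [|x|], take for [y] the foot of [x], where [K] peaks. Otherwise
    [omega x] is comparable to [|x| ^ M] and two small values of [u] are tried:
    they cannot both fail, since consecutive Gegenbauer polynomials have no
    common zero. A continuous bump near [y] of unit weighted norm is then mapped
    by the operator to a function whose value at [x] is at least a constant times
    [omega x] in modulus ([F_hump]). Along a subsequence of the given points on
    which [psi] is far below [omega], such bumps are summed with geometrically
    decreasing coefficients and well chosen signs: this is the gliding hump
    argument ([gliding_hump], [F_sharp]).

    Of the Gegenbauer polynomials only the three-term recurrence and a crude
    geometric bound are used. That the recurrence gives the coefficients of the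
    generating function is proved through the differential equation
    [(1 - 2 t z + z^2) S' = 2 lambda (t - z) S]. *)

(** * Power series with geometrically bounded coefficients *)

Lemma is_cvg_pseries_geometric (R : realType) (a : nat -> R) (D Q z : R) :
  (forall n, `|a n| <= D * Q ^+ n) -> 0 <= Q -> `|z| * Q < 1 ->
  cvgn (pseries a z).
Proof.
move=> aDQ Q0 zQ.
have D0 : 0 <= D by have := le_trans (normr_ge0 _) (aDQ 0%N); rewrite expr0 mulr1.
apply: normed_cvg; rewrite /=.
apply: (@series_le_cvg _ _ (geometric D (`|z| * Q))) => [n|n|n|] /=.
- by [].
- by rewrite mulr_ge0// exprn_ge0// mulr_ge0.
- rewrite normrM normrX exprMn mulrCA [leLHS]mulrC ler_wpM2l ?exprn_ge0//.
- by apply: is_cvg_geometric_series; rewrite ger0_norm ?mulr_ge0.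
Qed.

Lemma natr_le_exp2 (R : realType) n : n%:R <= 2 ^+ n :> R.
Proof. by rewrite -natrX ler_nat ltnW// ltn_expl. Qed.

Lemma pseries_diffs_geometric (R : realType) (a : nat -> R) (D Q : R) :
  (forall n, `|a n| <= D * Q ^+ n) -> 0 <= Q ->
  forall n, `|pseries_diffs a n| <= (2 * D * Q) * (2 * Q) ^+ n.
Proof.
move=> aDQ Q0 n; rewrite /pseries_diffs normrM normr_nat.
have -> : 2 * D * Q * (2 * Q) ^+ n = 2 ^+ n.+1 * (D * Q ^+ n.+1).
  by rewrite exprMn !exprS; ring.
by rewrite ler_pM// ?ler0n// natr_le_exp2.
Qed.

(** Each formal derivative doubles the geometric rate, because [n <= 2 ^ n]; two
    derivatives explain the factor 4. *)
Lemma is_derive_pseries_geometric (R : realType) (a : nat -> R) (D Q z : R) :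
  (forall n, `|a n| <= D * Q ^+ n) -> 0 <= Q -> `|z| * (4 * Q) < 1 ->
  is_derive z 1 (fun z => limn (pseries a z)) (limn (pseries (pseries_diffs a) z)).
Proof.
move=> aDQ Q0 zQ.
have a1 := @pseries_diffs_geometric _ _ _ _ aDQ Q0.
have Q20 : 0 <= 2 * Q by rewrite mulr_ge0.
have a2 := @pseries_diffs_geometric _ _ _ _ a1 Q20.
have [K [zK K0 KQ]] : exists K, [/\ `|z| < K, 0 < K & K * (4 * Q) < 1].
  have [->|Q00] := eqVneq Q 0.
    have h1 := normr_ge0 z.
    by exists (`|z| + 1); rewrite !mulr0; split; lra.
  have Qgt0 : 0 < 4 * Q by rewrite mulr_gt0// lt_def Q00.
  exists ((`|z| + (4 * Q)^-1) / 2).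
  have h : `|z| < (4 * Q)^-1 by rewrite -[ltRHS]mul1r ltr_pdivlMr.
  have h1 := normr_ge0 z.
  split.
  - lra.
  - have : 0 < (4 * Q)^-1 by rewrite invr_gt0. lra.
  - rewrite -ltr_pdivlMr//; lra.
have K1 Q' : 0 <= Q' -> Q' <= 4 * Q -> `|K| * Q' < 1.
  move=> Q'0 Q'Q; rewrite gtr0_norm//; apply: le_lt_trans KQ.
  by rewrite ler_wpM2l// ltW.
apply: (@pseries_snd_diffs _ _ K).
- by apply: (@is_cvg_pseries_geometric _ _ _ _ _ aDQ); rewrite ?K1//; lra.
- by apply: (@is_cvg_pseries_geometric _ _ _ _ _ a1); rewrite ?K1//; lra.
- by apply: (@is_cvg_pseries_geometric _ _ _ _ _ a2); rewrite ?K1//; lra.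
- by rewrite (gtr0_norm K0).
Qed.

(** * The generating function of the Gegenbauer polynomials *)

(** The three-term recurrence, evaluated at a point [t]. *)
Definition gegenbauer_seq (R : realType) (l t : R) (c : nat -> R) :=
  [/\ c 0%N = 1, c 1%N = 2 * l * t & forall n,
    n.+2%:R * c n.+2 = 2 * (n.+1%:R + l) * t * c n.+1 - (n%:R + 2 * l) * c n].

Lemma gegenbauer_seq_le (R : realType) (l t T : R) (c : nat -> R) : 0 < l ->
  gegenbauer_seq l t c -> `|t| <= T ->
  forall n, `|c n| <= (2 * T * (1 + l) + (1 + 2 * l)) ^+ n.
Proof.
move=> l0 [c0 c1 crec] tT; set B := 2 * T * (1 + l) + _.
have T0 : 0 <= T := le_trans (normr_ge0 t) tT.
have Tl0 : 0 <= 2 * T * (1 + l) by rewrite !mulr_ge0//; lra.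
have B1 : 1 <= B by rewrite /B; lra.
have l2T : 2 * l * T <= B.
  by rewrite /B; have := mulr_ge0 T0 (ltW l0); lra.
elim/ltn_ind => -[_|[_|n IH]].
- by rewrite c0 normr1 expr0.
- rewrite c1 expr1 !normrM gtr0_norm// (gtr0_norm l0).
  by apply: le_trans l2T; rewrite ler_wpM2l//; lra.
have n2 : 0 < n.+2%:R :> R by rewrite ltr0n.
have n0 : 0 <= n%:R :> R by rewrite ler0n.
rewrite -(ler_pM2l n2) -{1}(gtr0_norm n2) -normrM crec.
apply: (le_trans (ler_normB _ _)).
have IH1 := IH n.+1 (ltnSn _); have IH0 := IH n (ltnW (ltnSn _)).
have Bn : 0 <= B ^+ n by rewrite exprn_ge0// (le_trans _ B1).
have -> : n.+2%:R * B ^+ n.+2 =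
    n.+2%:R * (2 * T * (1 + l)) * B ^+ n.+1 + n.+2%:R * (1 + 2 * l) * B ^+ n.+1.
  by rewrite [B ^+ n.+2]exprS {1}/B; ring.
apply: lerD; rewrite normrM.
  apply: ler_pM => //.
  rewrite !normrM (gtr0_norm (ltr0Sn _ _)) gtr0_norm; last by rewrite -natr1; lra.
  have -> : n.+2%:R * (2 * T * (1 + l)) = 2 * (n.+2%:R * (1 + l)) * T by ring.
  apply: ler_pM => //; last first.
    rewrite ler_pM2l// -!natr1; have := mulr_ge0 n0 (ltW l0); lra.
  rewrite mulr_ge0//; rewrite -natr1; lra.
have -> : n.+2%:R * (1 + 2 * l) * B ^+ n.+1 = n.+2%:R * (1 + 2 * l) * B * B ^+ n.
  by rewrite exprS; ring.
apply: ler_pM => //.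
rewrite ger0_norm; last lra.
have h : n%:R + 2 * l <= n.+2%:R * (1 + 2 * l).
  by rewrite -!natr1; have := mulr_ge0 n0 (ltW l0); lra.
apply: (le_trans h); rewrite ler_peMr//.
by rewrite mulr_ge0//; lra.
Qed.

(** Coefficientwise the recurrence says that the generating function [S]
    satisfies [(1 - 2 t z + z^2) S' = 2 l (t - z) S]; on partial sums the
    equation fails only by a boundary term. *)
Lemma gegenbauer_ode_partial (R : realType) (l t : R) (c : nat -> R) z n :
  gegenbauer_seq l t c ->
  (1 - 2 * t * z + z ^+ 2) * (\sum_(0 <= i < n) pseries_diffs c i * z ^+ i) -
  2 * l * (t - z) * (\sum_(0 <= i < n) c i * z ^+ i) =
  z ^+ n * (2 * t * l * c n - n.+1%:R * c n.+1) + z ^+ n.+1 * (n%:R * c n).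
Proof.
move=> [c0 c1 crec]; elim: n => [|n IH].
  by rewrite !big_geq// c0 c1 expr0 expr1; ring.
rewrite !big_nat_recr//= /pseries_diffs in IH *.
rewrite [X in X - _]mulrDr [X in _ - X]mulrDr opprD addrACA IH crec !exprS -!natr1.
ring.
Qed.

Lemma gegenbauer_ode (R : realType) (l t : R) (c : nat -> R) (D Q z : R) :
  gegenbauer_seq l t c -> (forall n, `|c n| <= D * Q ^+ n) -> 0 <= Q ->
  `|z| * (4 * Q) < 1 ->
  (1 - 2 * t * z + z ^+ 2) * limn (pseries (pseries_diffs c) z) =
  2 * l * (t - z) * limn (pseries c z).
Proof.
move=> cg cDQ Q0 zQ.
have zQ2 : `|z| * (2 * Q) < 1.
  by apply: le_lt_trans zQ; rewrite ler_wpM2l//; lra.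
have zQ1 : `|z| * Q < 1.
  by apply: le_lt_trans zQ2; rewrite ler_wpM2l//; lra.
have cv := @is_cvg_pseries_geometric _ _ _ _ _ cDQ Q0 zQ1.
have Q20 : 0 <= 2 * Q by rewrite mulr_ge0.
have cv1 := @is_cvg_pseries_geometric _ _ _ _ _
   (@pseries_diffs_geometric _ _ _ _ cDQ Q0) Q20 zQ2.
apply/eqP; rewrite -subr_eq0; apply/eqP.
pose e n := z ^+ n * (2 * t * l * c n - n.+1%:R * c n.+1) + z ^+ n.+1 * (n%:R * c n).
have e1 : e @ \oo --> (1 - 2 * t * z + z ^+ 2) * limn (pseries (pseries_diffs c) z) -
  2 * l * (t - z) * limn (pseries c z).
  rewrite (_ : e = fun n => (1 - 2 * t * z + z ^+ 2) * pseries (pseries_diffs c) z n -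
    2 * l * (t - z) * pseries c z n); last first.
    by apply/funext => n; rewrite /pseries /series/= gegenbauer_ode_partial.
  by apply: cvgB; apply: cvgMl_tmp.
have e0 : e @ \oo --> (0 : R).
  rewrite -(cvg_shiftS e) /=.
  have u0 : (fun n => c n * z ^+ n) @ \oo --> (0 : R) by exact: cvg_series_cvg_0 cv.
  have v0 : (fun n => pseries_diffs c n * z ^+ n) @ \oo --> (0 : R).
    exact: cvg_series_cvg_0 cv1.
  have us0 : (fun n => c n.+1 * z ^+ n.+1) @ \oo --> (0 : R).
    by rewrite (cvg_shiftS (fun n => c n * z ^+ n)).
  have vs0 : (fun n => pseries_diffs c n.+1 * z ^+ n.+1) @ \oo --> (0 : R).
    by rewrite (cvg_shiftS (fun n => pseries_diffs c n * z ^+ n)).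
  rewrite (_ : (fun n => e n.+1) = fun n => 2 * t * l * (c n.+1 * z ^+ n.+1)
     - (pseries_diffs c n.+1 * z ^+ n.+1) + z ^+ 2 * (pseries_diffs c n * z ^+ n)); last first.
    by apply/funext => n; rewrite /e /pseries_diffs !exprS; ring.
  have := cvgD (cvgB (@cvgMl_tmp _ _ _ _ _ (2 * t * l) _ us0) vs0)
    (@cvgMl_tmp _ _ _ _ _ (z ^+ 2) _ v0).
  by rewrite !mulr0 subr0 addr0; apply.
exact: (cvg_unique _ e1 e0).
Qed.

(** By the differential equation [S w * (1 - 2 t w + w^2) ^ l] has derivative 0,
    hence keeps its value 1 at the origin. *)
Lemma gegenbauer_series (R : realType) (l t : R) (c : nat -> R) (D Q z : R) :
  gegenbauer_seq l t c -> (forall n, `|c n| <= D * Q ^+ n) -> 0 <= Q ->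
  `|z| * (4 * Q) < 1 ->
  (forall w : R, `|w| <= `|z| -> 0 < 1 - 2 * t * w + w ^+ 2) ->
  pseries c z @ \oo --> (1 - 2 * t * z + z ^+ 2) `^ (- l).
Proof.
move=> cg cDQ Q0 zQ pos.
pose q w : R := 1 - 2 * t * w + w ^+ 2.
pose S w : R := limn (pseries c w).
pose g w : R := S w * (q w) `^ l.
have dq (w : R) : is_derive w 1 q (2 * (w - t)).
  rewrite /q; apply: is_derive_eq; rewrite !scaler1 /GRing.scale/=; ring.
have wQ (w : R) : `|w| <= `|z| -> `|w| * (4 * Q) < 1.
  by move=> wz; apply: le_lt_trans zQ; rewrite ler_wpM2r// mulr_ge0.
have dg (w : R) : `|w| <= `|z| -> is_derive w 1 g 0.
  move=> wz.
  have dS := @is_derive_pseries_geometric _ _ _ _ _ cDQ Q0 (wQ _ wz).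
  have dpq : is_derive w 1 (fun w => q w `^ l) (l * (q w) `^ (l - 1) * (2 * (w - t))).
    have dp : is_derive (q w) 1 (fun y => y `^ l) (l * (q w) `^ (l - 1)).
      exact: is_derive1_powR (pos _ wz).
    exact: is_derive1_comp dp (dq w).
  have dM := @is_deriveM _ _ S (fun w => q w `^ l) w 1 _ _ dS dpq.
  apply: (@is_derive_eq _ _ _ _ _ _ _ _ dM).
  rewrite /GRing.scale/=.
  have q0 := pos _ wz; rewrite -/(q w) in q0.
  have -> : q w `^ l = q w * q w `^ (l - 1).
    by rewrite -{2}[q w]powRr1 ?ltW// -powRD ?(gt_eqF q0) ?implybT// addrC subrK.
  have := @gegenbauer_ode _ _ _ _ _ _ w cg cDQ Q0 (wQ _ wz); rewrite -/(q w) => ode.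
  rewrite [X in _ + X](_ : _ = q w `^ (l - 1) *
    (q w * limn (pseries (pseries_diffs c) w))); last first.
    by rewrite /=; ring.
  by rewrite ode /S; ring.
have gc : g z = g 0.
  have cst a b : a <= b -> (forall w, w \in `[a, b] -> `|w| <= `|z|) -> g b = g a.
    move=> ab abz.
    have [x /itvP xab||y _] := @MVT_segment _ g (fun=> 0) a b ab.
    - by apply: dg; apply: abz; rewrite in_itv/= !xab.
    - apply: derivable_within_continuous => x /abz xz.
      by have [] := dg _ xz.
    - by rewrite mul0r => /eqP; rewrite subr_eq0 => /eqP.
  have [z0|z0] := leP 0 z.
    apply: cst => // w; rewrite in_itv/= => /andP[w0 wz].
    by rewrite !ger0_norm.
  symmetry; apply: cst; first exact: ltW.
  move=> w; rewrite in_itv/= => /andP[w0 wz].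
  by rewrite (ltr0_norm z0) ler0_norm// lerN2.
have [c0 _ _] := cg.
have g0 : g 0 = 1.
  rewrite /g /q /S mulr0 expr0n/= subr0 addr0 powR1 mulr1.
  apply: cvg_lim => //; rewrite -(cvg_shiftS (pseries c 0)).
  rewrite (_ : (fun n => _) = fun=> 1); first exact: cvg_cst.
  apply/funext => n; rewrite /pseries /series/= big_nat_recl// expr0 mulr1 c0.
  by rewrite big1 ?addr0// => i _; rewrite expr0n mulr0.
have qz := pos _ (lexx _); rewrite -/(q z) in qz *.
have -> : q z `^ (- l) = limn (pseries c z).
  rewrite powRN; apply/(mulIf (x := q z `^ l)); first by rewrite gt_eqF// powR_gt0.
  by rewrite mulVf ?gt_eqF ?powR_gt0// -[1]g0 -gc.
have zQ1 : `|z| * Q < 1.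
  by apply: le_lt_trans zQ; rewrite ler_wpM2l//; lra.
exact: (@is_cvg_pseries_geometric _ _ _ _ _ cDQ Q0 zQ1).
Qed.

(** If [c n] is the first nonzero coefficient, dividing the series by [z ^ n]
    gives a function continuous at 0, with value [c n] there, that vanishes at the
    other points near 0. *)
Lemma pseries_eq0 (R : realType) (c : nat -> R) :
  (\forall z \near (0 : R), pseries c z @ \oo --> (0 : R)) -> forall n, c n = 0.
Proof.
move=> c0.
have [z0 z00 cz] : exists2 z0 : R, 0 < z0 &
    forall z, `|z| <= z0 -> pseries c z @ \oo --> (0 : R).
  move/nbhs_ballP : c0 => [e /= e0 he]; exists (e / 2); first by rewrite divr_gt0.
  move=> z ze; apply: he; rewrite /ball/= sub0r normrN.
  by apply: le_lt_trans ze _; rewrite ltr_pdivrMr// ltr_pMr// ltr1n.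
have [D hD] : exists D, forall n, `|c n| * z0 ^+ n <= D.
  have /cz/cvgP/cvg_series_cvg_0/cvgP/cvg_seq_bounded/pinfty_ex_gt0[D _ hD] :
    `|z0| <= z0 by rewrite gtr0_norm.
  by exists D => n; have := hD n I; rewrite /= normrM normrX (gtr0_norm z00).
elim/ltn_ind => n IH.
pose d k := c (n + k)%N.
have dD k : `|d k| <= (D * z0^-1 ^+ n) * z0^-1 ^+ k.
  rewrite -mulrA -exprD exprVn ler_pdivlMr ?exprn_gt0//; exact: hD.
have dz z : z != 0 -> `|z| <= z0 -> limn (pseries d z) = 0.
  move=> zn0 zz0; apply: cvg_lim => //.
  rewrite (_ : pseries d z = fun N => z ^- n * pseries c z (N + n)%N).
    rewrite -(mulr0 (z ^- n)); apply: cvgMl_tmp.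
    by have := cz _ zz0; rewrite -(cvg_shiftn n).
  apply/funext => N; rewrite /pseries /series/= mulr_sumr.
  rewrite (@big_cat_nat _ _ _ n 0 (N + n))//= ?leq_addl//.
  rewrite [X in _ = X + _]big1_seq ?add0r; last first.
    by move=> i; rewrite mem_index_iota => /andP[_ /andP[_ ni]]; rewrite IH// mul0r mulr0.
  rewrite -{1}[n]add0n big_addn addnK.
  apply: eq_big_nat => i _; rewrite /d addnC exprD [RHS]mulrC mulrA mulfK//.
  by rewrite expf_neq0.
have zi0 : 0 <= z0^-1 by rewrite invr_ge0 ltW.
have := @is_derive_pseries_geometric _ _ _ _ 0 dD zi0.
rewrite normr0 mul0r => /(_ ltr01)[/derivable1_diffP/differentiable_continuous cont _].
have : limn (pseries d 0) = 0.
  apply: (@cvg_unique _ _ ((fun z => limn (pseries d z)) @ (0:R)^')) => //.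
    exact: cvg_within_filter.
  apply: cvg_near_cst; rewrite near_withinE.
  by apply: filterS (nbhs0_le z00) => z zz0 zn0; exact: dz.
have -> : limn (pseries d 0) = d 0%N.
  apply: cvg_lim => //; rewrite -(cvg_shiftS (pseries d 0)).
  rewrite (_ : (fun n => _) = fun=> d 0%N); first exact: cvg_cst.
  apply/funext => k; rewrite /pseries /series/= big_nat_recl// expr0 mulr1.
  by rewrite big1 ?addr0// => i _; rewrite expr0n mulr0.
by rewrite /d addn0.
Qed.

Lemma pseries_inj (R : realType) (a b : nat -> R) (s : R -> R) :
  (\forall z \near (0 : R), pseries a z @ \oo --> s z) ->
  (\forall z \near (0 : R), pseries b z @ \oo --> s z) -> a = b.
Proof.
move=> ha hb; apply/funext => n; apply/eqP; rewrite -subr_eq0; apply/eqP.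
apply: (@pseries_eq0 _ (fun n => a n - b n)); near=> z.
rewrite (_ : pseries _ z = fun N => pseries a z N - pseries b z N); last first.
  apply/funext => N; rewrite /pseries /series/= -sumrB.
  by apply: eq_bigr => i _; rewrite mulrBl.
by rewrite -(subrr (s z)); apply: cvgB; near: z.
Unshelve. all: by end_near. Qed.

(** Pairs of consecutive polynomials turn the three-term recurrence into a
    structural recursion. *)
Fixpoint gegenbauer_pair (R : realType) (l : R) (n : nat) : {poly R} * {poly R} :=
  if n is m.+1 then
    let p := gegenbauer_pair l m in
    (p.2, m.+2%:R^-1 *: ((2 * (m.+1%:R + l)) *: ('X * p.2) - (m%:R + 2 * l) *: p.1))
  else (1, (2 * l) *: 'X).

Lemma gegenbauer_pairP (R : realType) (l t : R) :
  gegenbauer_seq l t (fun n => (gegenbauer_pair l n).1.[t]).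
Proof.
split=> [||n]; rewrite /= !hornerE//.
by rewrite /= divff ?pnatr_eq0// mul1r.
Qed.

(** The disc on which the geometric bound gives convergence is small enough for
    [1 - 2 t w + w^2] to be positive on it. *)
Lemma gegenbauer_seq_series (R : realType) (l t T z : R) (c : nat -> R) : 0 < l ->
  gegenbauer_seq l t c -> `|t| <= T ->
  `|z| * (4 * (2 * T * (1 + l) + (1 + 2 * l))) < 1 ->
  pseries c z @ \oo --> (1 - 2 * t * z + z ^+ 2) `^ (- l).
Proof.
move=> l0 cg tT zB.
have T0 : 0 <= T := le_trans (normr_ge0 t) tT.
have Tl0 : 0 <= T * l by rewrite mulr_ge0// ltW.
apply: (@gegenbauer_series _ _ _ _ 1 (2 * T * (1 + l) + (1 + 2 * l))) => //.
- by move=> n; rewrite mul1r; exact: gegenbauer_seq_le l0 cg tT n.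
- by lra.
move=> w wz.
have h : 2 * (t * w) <= 2 * T * `|z|.
  rewrite -mulrA ler_pM2l//; apply: le_trans (ler_norm _) _.
  by rewrite normrM ler_pM.
have z0 := normr_ge0 z.
have h2 : 0 <= `|z| * (T * l) by rewrite mulr_ge0.
have h3 : 0 <= `|z| * T by rewrite mulr_ge0.
have h4 : 0 <= `|z| * l by rewrite mulr_ge0// ltW.
have h5 := sqr_ge0 w.
lra.
Qed.

(** The recurrence provides a solution of the generating function property, and
    uniqueness of power series makes it the one selected by [gegenbauer]. *)
Lemma gegenbauerE (R : realType) (l : R) : 0 < l ->
  gegenbauer l = fun n => (gegenbauer_pair l n).1.
Proof.
move=> l0.
have gfP : gegenbauer_gf l (fun n => (gegenbauer_pair l n).1).
  move=> t; set B := 4 * (2 * `|t| * (1 + l) + (1 + 2 * l)).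
  have B0 : 0 < B.
    have tl : 0 <= `|t| * l by rewrite mulr_ge0// ltW.
    have := normr_ge0 t; rewrite /B; lra.
  have Bi0 : 0 < B^-1 by rewrite invr_gt0.
  apply: filterS (nbhs0_lt Bi0) => z zB.
  rewrite (_ : (fun m => _) = (fun n => (gegenbauer_pair l n).1.[t] * z ^+ n)); last first.
    by apply/funext => n; rewrite mulrC.
  apply: (@gegenbauer_seq_series _ l t `|t|) => //; first exact: gegenbauer_pairP.
  by rewrite -/B -ltr_pdivlMr// mul1r.
apply/funext => n; rewrite /gegenbauer.
case: xgetP => [C _ gfC|/(_ _ gfP)//].
apply/eqP; rewrite -subr_eq0; apply/eqP.
have C0 : forall t, (C n - (gegenbauer_pair l n).1).[t] = 0.
  move=> t; rewrite hornerD hornerN.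
  have /(congr1 (@^~ n)) /= -> : (fun n => (C n).[t]) = (fun n => (gegenbauer_pair l n).1.[t]).
    apply: (@pseries_inj _ _ _ (fun z => (1 - 2 * t * z + z ^+ 2) `^ (- l))).
      apply: filterS (gfC t) => z; rewrite /pseries.
      by under eq_fun do rewrite mulrC.
    apply: filterS (gfP t) => z; rewrite /pseries.
    by under eq_fun do rewrite mulrC.
  by rewrite subrr.
apply/eqP; apply/negPn/negP => p0.
have := @max_poly_roots _ _ [seq i%:R | i <- iota 0 (size (C n - (gegenbauer_pair l n).1)%R)] p0.
rewrite size_map size_iota ltnn => h; apply/notF/h.
  by apply/allP => x _; apply/rootP.
by rewrite map_inj_uniq ?iota_uniq// => i j /eqP; rewrite eqr_nat => /eqP.
Qed.

Lemma gegenbauerP (R : realType) (l t : R) : 0 < l ->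
  gegenbauer_seq l t (fun n => (gegenbauer l n).[t]).
Proof. by move=> l0; rewrite gegenbauerE//; exact: gegenbauer_pairP. Qed.

Definition gegenbauer_rate (R : realType) (l : R) : R := 3 + 4 * l.

Lemma gegenbauer_le (R : realType) (l t : R) n : 0 < l -> `|t| <= 1 ->
  `|(gegenbauer l n).[t]| <= gegenbauer_rate l ^+ n.
Proof.
move=> l0 t1; have := gegenbauer_seq_le l0 (gegenbauerP t l0) t1 n.
by congr (_ <= _ ^+ _); rewrite /gegenbauer_rate; ring.
Qed.

Lemma gegenbauer_remainder (R : realType) (l t u : R) M : 0 < l -> `|t| <= 1 ->
  0 <= u -> u * (4 * gegenbauer_rate l) < 1 ->
  `|(1 - 2 * t * u + u ^+ 2) `^ (- l) - \sum_(m < M) u ^+ m * (gegenbauer l m).[t]|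
    <= 2 * (gegenbauer_rate l * u) ^+ M.
Proof.
move=> l0 t1 u0 uB; set B := gegenbauer_rate l in uB *.
have B0 : 0 <= B by rewrite /B /gegenbauer_rate; lra.
pose c m := (gegenbauer l m).[t].
have cv : pseries c u @ \oo --> (1 - 2 * t * u + u ^+ 2) `^ (- l).
  apply: (gegenbauer_seq_series l0 (gegenbauerP t l0) t1).
  by rewrite ger0_norm//; apply: le_lt_trans uB; rewrite ler_wpM2l// /B /gegenbauer_rate; lra.
have -> : \sum_(m < M) u ^+ m * (gegenbauer l m).[t] = pseries c u M.
  by rewrite /pseries /series/= big_mkord; apply: eq_bigr => i _; rewrite mulrC.
have : (fun n => `|pseries c u n - pseries c u M|) @ \oo -->
   `|(1 - 2 * t * u + u ^+ 2) `^ (- l) - pseries c u M|.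
  by apply: cvg_norm; apply: cvgB => //; exact: cvg_cst.
move=> cvn.
rewrite -(cvg_lim (@Rhausdorff R) cvn); apply: limr_le.
  by apply/cvg_ex; eexists; exact: cvn.
near=> n.
have Mn : (M <= n)%N by near: n; exact: nbhs_infty_ge.
rewrite /pseries sub_series Mn.
apply: le_trans (ler_norm_sum _ _ _) _.
have Bu0 : 0 <= B * u by rewrite mulr_ge0.
apply: (@le_trans _ _ (\sum_(M <= i < n) (B * u) ^+ i)).
  apply: ler_sum => i _; rewrite normrM normrX (ger0_norm u0) exprMn ler_wpM2r ?exprn_ge0//.
  exact: gegenbauer_le.
have Bu2 : B * u <= 1 / 2 by lra.
have geo k : \sum_(M <= i < M + k) (B * u) ^+ i <= 2 * (B * u) ^+ M - 2 * (B * u) ^+ (M + k).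
  have BM : 0 <= (B * u) ^+ M by rewrite exprn_ge0.
  elim: k => [|k IH]; first by rewrite addn0 big_geq//; lra.
  rewrite addnS big_nat_recr ?leq_addr//= exprS.
  have h : 0 <= (B * u) ^+ (M + k) by rewrite exprn_ge0.
  have := ler_wpM2r h Bu2; lra.
apply: le_trans (_ : 2 * (B * u) ^+ M - 2 * (B * u) ^+ n <= _).
  by have := geo (n - M)%N; rewrite subnKC.
by rewrite gerBl mulr_ge0// exprn_ge0.
Unshelve. all: by end_near. Qed.

(** Consecutive Gegenbauer polynomials have no common zero: read backwards,
    the recurrence bounds each by the two next ones, down to [C_0 = 1]. *)
Lemma gegenbauer_consecutive (R : realType) (l : R) M : 0 < l ->
  exists2 c : R, 0 < c & forall t, `|t| <= 1 ->
    c <= `|(gegenbauer l M).[t]| + `|(gegenbauer l M.+1).[t]|.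
Proof.
move=> l0; elim: M => [|M [c c0 IH]].
  by exists 1 => // t _; have [-> _ _] := gegenbauerP t l0; rewrite normr1 lerDl.
pose k : R := (2 * (M.+1%:R + l) + M.+2%:R) / (M%:R + 2 * l).
have M0 : 0 <= M%:R :> R by rewrite ler0n.
have Ml : 0 < M%:R + 2 * l by lra.
have k0 : 0 <= k by rewrite /k divr_ge0// -?natr1; lra.
exists (c / (1 + k)) => [|t t1]; first by rewrite divr_gt0//; lra.
have [_ _ /(_ M)] := gegenbauerP t l0.
set a := _.[t]; set b := _.[t]; set d := _.[t] => rec.
have k1 : 0 < 1 + k by lra.
have bd : `|d| <= k * (`|b| + `|a|).
  rewrite /k mulrAC ler_pdivlMr// -{1}(gtr0_norm Ml) -normrM mulrC.
  have -> : (M%:R + 2 * l) * d = 2 * (M.+1%:R + l) * t * b - M.+2%:R * a by rewrite rec; ring.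
  apply: le_trans (ler_normB _ _) _; rewrite !normrM normr_nat.
  rewrite (gtr0_norm (ltr0Sn _ _)) (@gtr0_norm _ (M.+1%:R + l)); last by rewrite -natr1; lra.
  have h : 2 * (M.+1%:R + l) * `|t| * `|b| <= 2 * (M.+1%:R + l) * `|b|.
    rewrite ler_wpM2r// ler_piMr// mulr_ge0// -natr1; lra.
  apply: le_trans (lerD h (lexx _)) _.
  have h1 : 0 <= 2 * (M.+1%:R + l) * `|a| by rewrite !mulr_ge0// -natr1; lra.
  have h2 : 0 <= M.+2%:R * `|b| :> R by rewrite mulr_ge0.
  lra.
rewrite ler_pdivrMr//.
apply: le_trans (IH t t1) _; rewrite -/d -/b.
have := normr_ge0 a; have := normr_ge0 b; lra.
Qed.

(** By [gegenbauer_remainder] at order [M + 2], the remainder at [u] is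
    [u ^ M * (a + u * b)] up to [O(u ^ (M + 2))], where [a] and [b] are the
    values of two consecutive Gegenbauer polynomials. Since [a] and [b] are not
    both small, [a + e * b] and [a + e / 2 * b] are not both small. *)
Lemma gegenbauer_remainder_ge (R : realType) (l : R) M : 0 < l ->
  exists e c : R, [/\ 0 < e, e <= 1, 0 < c & forall t, `|t| <= 1 ->
    exists2 u, (u == e) || (u == e / 2) &
    c * u ^+ M <=
    `|(1 - 2 * t * u + u ^+ 2) `^ (- l) - \sum_(m < M) u ^+ m * (gegenbauer l m).[t]|].
Proof.
move=> l0; have [c0 c00 hc] := gegenbauer_consecutive M l0.
set B := gegenbauer_rate l.
have B1 : 1 < B by rewrite /B /gegenbauer_rate; lra.
have BM : 0 < B ^+ M.+2 by rewrite exprn_gt0//; lra.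
(* The first bound keeps [u] in the disc of convergence, the second makes the
   quadratic error smaller than half of the main term. *)
pose e := Num.min (8 * B)^-1 (c0 / (28 * B ^+ M.+2)).
have e0 : 0 < e.
  by rewrite /e lt_min; apply/andP; split; [rewrite invr_gt0; lra|rewrite divr_gt0// mulr_gt0].
have e8 : e * (8 * B) <= 1.
  rewrite -ler_pdivlMr; last lra.
  by rewrite mul1r /e ge_min lexx.
have e28 : e * (28 * B ^+ M.+2) <= c0.
  have B28 : 0 < 28 * B ^+ M.+2 by rewrite mulr_gt0.
  rewrite -ler_pdivlMr//.
  by rewrite /e ge_min lexx orbT.
have e1 : e <= 1 by nra.
exists e, (e * c0 / 14); split => //; first by rewrite divr_gt0// mulr_gt0.
move=> t t1.
pose a := (gegenbauer l M).[t]; pose b := (gegenbauer l M.+1).[t].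
pose h u := (1 - 2 * t * u + u ^+ 2) `^ (- l) - \sum_(m < M) u ^+ m * (gegenbauer l m).[t].
have near_h (u : R) : 0 < u -> u <= e ->
    u ^+ M * (`|a + u * b| - 2 * B ^+ M.+2 * e ^+ 2) <= `|h u|.
  move=> u0 ue.
  have uB : u * (4 * B) < 1 by nra.
  have := @gegenbauer_remainder _ _ _ _ M.+2 l0 t1 (ltW u0) uB.
  rewrite !big_ord_recr/= -/a -/b -/B => rem.
  have uM : 0 < u ^+ M by rewrite exprn_gt0.
  have -> : h u = u ^+ M * (a + u * b) + (h u - u ^+ M * (a + u * b)) by ring.
  apply: le_trans (lerB_normD _ _); rewrite normrM (gtr0_norm uM) mulrBr lerB//.
  rewrite (_ : h u - _ = (1 - 2 * t * u + u ^+ 2) `^ (- l) -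
    (\sum_(m < M) u ^+ m * (gegenbauer l m).[t] + u ^+ M * a + u ^+ M.+1 * b)); last first.
    by rewrite /h (exprS u M); ring.
  apply: le_trans rem _.
  rewrite exprMn (_ : u ^+ M.+2 = u ^+ M * u ^+ 2); last by rewrite -exprD addn2.
  have -> : u ^+ M * (2 * B ^+ M.+2 * e ^+ 2) = 2 * (B ^+ M.+2 * (u ^+ M * e ^+ 2)) by ring.
  rewrite ler_pM2l// ler_pM2l// ler_pM2l// lerXn2r// ?nnegrE; lra.
have cM (u : R) : 0 < u -> e * c0 / 7 <= `|a + u * b| -> u <= e ->
    e * c0 / 14 * u ^+ M <= `|h u|.
  move=> u0 ab ue; apply: le_trans (near_h u u0 ue).
  rewrite mulrC; apply: ler_wpM2l; first by rewrite exprn_ge0// ltW.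
  have -> : 2 * B ^+ M.+2 * e ^+ 2 = e * (e * (28 * B ^+ M.+2)) / 14 by rewrite expr2; lra.
  have : e * (e * (28 * B ^+ M.+2)) <= e * c0 by rewrite ler_pM2l.
  lra.
have [h1|h1] := leP (e * c0 / 7) `|a + e * b|.
  by exists e; rewrite ?eqxx//; exact: cM.
have [h2|h2] := leP (e * c0 / 7) `|a + e / 2 * b|.
  by exists (e / 2); rewrite ?eqxx ?orbT//; apply: cM => //; lra.
exfalso; have := hc t t1; rewrite -/a -/b => hab.
have ha : `|a| <= 2 * `|a + e / 2 * b| + `|a + e * b|.
  rewrite [X in `|X| <= _](_ : _ = 2 * (a + e / 2 * b) - (a + e * b)); last by lra.
  by apply: le_trans (ler_normB _ _) _; rewrite normrM (@gtr0_norm _ 2).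
have hb : e * `|b| <= 2 * `|a + e / 2 * b| + 2 * `|a + e * b|.
  rewrite -{1}(gtr0_norm e0) -normrM.
  rewrite [X in `|X| <= _](_ : _ = 2 * (a + e * b) - 2 * (a + e / 2 * b)); last by lra.
  by apply: le_trans (ler_normB _ _) _; rewrite !normrM (@gtr0_norm _ 2)// addrC.
have : e * c0 <= `|a| + e * `|b|.
  apply: (@le_trans _ _ (e * (`|a| + `|b|))); first by rewrite ler_pM2l.
  by rewrite mulrDr lerD2r ler_piMl.
lra.
Qed.

(** * Euclidean geometry of the half space *)

Section geometry.
Context {R : realType}.

Lemma dotC n (u v : 'rV[R]_n) : dot u v = dot v u.
Proof. by apply: eq_bigr => i _; rewrite mulrC. Qed.

Lemma dotDl n (u v w : 'rV[R]_n) : dot (u + v) w = dot u w + dot v w.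
Proof. by rewrite -big_split; apply: eq_bigr => i _; rewrite mxE mulrDl. Qed.

Lemma dotZl n a (u w : 'rV[R]_n) : dot (a *: u) w = a * dot u w.
Proof. by rewrite mulr_sumr; apply: eq_bigr => i _; rewrite mxE mulrA. Qed.

Lemma dotBl n (u v w : 'rV[R]_n) : dot (u - v) w = dot u w - dot v w.
Proof. by rewrite dotDl -scaleN1r dotZl mulN1r. Qed.

Lemma dot_ge0 n (u : 'rV[R]_n) : 0 <= dot u u.
Proof. by apply: sumr_ge0 => i _; rewrite -expr2 sqr_ge0. Qed.

Lemma dotvv n (u : 'rV[R]_n) : dot u u = enorm u ^+ 2.
Proof. by rewrite sqr_sqrtr// dot_ge0. Qed.

Lemma enorm_ge0 n (u : 'rV[R]_n) : 0 <= enorm u.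
Proof. exact: sqrtr_ge0. Qed.

Lemma enorm_eq0 n (u : 'rV[R]_n) : enorm u = 0 -> u = 0.
Proof.
move=> u0; have /eqP : dot u u = 0 by rewrite dotvv u0 expr0n.
rewrite psumr_eq0 => [/allP u00|i _]; last by rewrite -expr2 sqr_ge0.
apply/rowP => i; have := u00 i (mem_index_enum _).
by rewrite mulf_eq0 orbb mxE => /eqP.
Qed.

Lemma enormZ n a (u : 'rV[R]_n) : 0 <= a -> enorm (a *: u) = a * enorm u.
Proof.
move=> a0; rewrite /enorm dotZl dotC dotZl mulrA -expr2.
by rewrite sqrtrM ?sqr_ge0// sqrtr_sqr ger0_norm.
Qed.

Lemma cauchy_schwarz n (u v : 'rV[R]_n) : `|dot u v| <= enorm u * enorm v.
Proof.
have [v0|v0] := eqVneq (enorm v) 0.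
  rewrite v0 mulr0 (enorm_eq0 v0) /dot big1 ?normr0// => i _.
  by rewrite mxE mulr0.
have vp : 0 < enorm v by rewrite lt_def v0 enorm_ge0.
rewrite -(@ler_pXn2r _ 2)// ?nnegrE ?mulr_ge0 ?enorm_ge0// real_normK ?num_real//.
rewrite exprMn -(ler_pM2l (exprn_gt0 2 vp)).
have := dot_ge0 (enorm v ^+ 2 *: u - dot u v *: v).
rewrite dotBl !dotZl ![dot _ (_ - _)]dotC !dotBl !dotZl !dotvv (dotC v u) => h.
rewrite -subr_ge0 (le_trans h)// le_eqVlt; apply/orP; left; apply/eqP; ring.
Qed.

Variable (d : nat).
Implicit Types (x : 'rV[R]_d.+1) (y : 'rV[R]_d).

Lemma enorm_proj x : enorm x ^+ 2 = enorm (Defs.proj x) ^+ 2 + x 0 ord_max ^+ 2.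
Proof.
rewrite -!dotvv /dot big_ord_recr/= expr2; congr (_ + _).
by apply: eq_bigr => i _; rewrite mxE.
Qed.

Lemma enorm_proj_le x : enorm (Defs.proj x) <= enorm x.
Proof.
rewrite -(@ler_pXn2r _ 2)// ?nnegrE ?enorm_ge0//.
by rewrite [leRHS]enorm_proj lerDl sqr_ge0.
Qed.

Lemma height_le_enorm x : x 0 ord_max <= enorm x.
Proof.
have [x0|x0] := leP (x 0 ord_max) 0; first exact: le_trans (enorm_ge0 _).
rewrite -(@ler_pXn2r _ 2)// ?nnegrE ?enorm_ge0 ?(ltW x0)//.
by rewrite [leRHS]enorm_proj lerDr sqr_ge0.
Qed.

Lemma half_space_enorm x : half_space x -> 0 < enorm x.
Proof. by move=> x0; apply: lt_le_trans (height_le_enorm x). Qed.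

Lemma cos_theta x : cos (theta x) = x 0 ord_max / enorm x.
Proof.
have e1 : enorm (delta_mx 0 ord_max : 'rV[R]_d.+1) = 1.
  rewrite /enorm /dot (bigD1 ord_max)//= big1 ?addr0 ?mxE ?eqxx ?mulr1 ?sqrtr1//.
  by move=> i /negPf i0; rewrite mxE eqxx i0 mulr0.
rewrite /theta /angle e1 mulr1.
have -> : dot x (delta_mx 0 ord_max) = x 0 ord_max.
  rewrite /dot (bigD1 ord_max)//= big1 ?addr0 ?mxE ?eqxx ?mulr1//.
  by move=> i /negPf i0; rewrite mxE eqxx i0 mulr0.
rewrite acosK// in_itv/= -ler_norml normrM normfV (ger0_norm (enorm_ge0 _)).
have [->|x0] := eqVneq (enorm x) 0; first by rewrite invr0 mulr0.
rewrite ler_pdivrMr ?mul1r ?lt_def ?x0 ?enorm_ge0//.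
by rewrite -(@ler_pXn2r _ 2)// ?nnegrE ?enorm_ge0// real_normK ?num_real//
  [leRHS]enorm_proj lerDr sqr_ge0.
Qed.

Lemma sin_theta x : half_space x -> sin (theta x) = enorm (Defs.proj x) / enorm x.
Proof.
move=> hx; have x0 := half_space_enorm hx.
have := cos_theta x; rewrite /theta /angle.
set c := _ / (_ * _) => cE.
have c1 : -1 <= c <= 1.
  rewrite -ler_norml normrM normfV (@ger0_norm _ (_ * _)) ?mulr_ge0 ?enorm_ge0//.
  have [->|n0] := eqVneq (enorm x * enorm (delta_mx 0 ord_max : 'rV[R]_d.+1)) 0.
    by rewrite invr0 mulr0.
  by rewrite ler_pdivrMr ?mul1r ?cauchy_schwarz// lt_def n0 mulr_ge0 ?enorm_ge0.
rewrite sin_acos// -[c]acosK ?in_itv//= cE.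
rewrite -[RHS]ger0_norm ?divr_ge0 ?enorm_ge0// -sqrtr_sqr; congr Num.sqrt.
rewrite !expr_div_n; apply: (mulIf (x := enorm x ^+ 2)).
  by rewrite expf_neq0// gt_eqF.
rewrite mulrBl !divfK ?mul1r ?expf_neq0 ?gt_eqF// enorm_proj addrK//.
Qed.

Lemma cos_theta' x y :
  cos (theta' x y) = dot (Defs.proj x) y / (enorm (Defs.proj x) * enorm y).
Proof.
rewrite /theta' /angle acosK// in_itv/= -ler_norml normrM normfV.
rewrite (@ger0_norm _ (_ * _)) ?mulr_ge0 ?enorm_ge0//.
have [->|x0] := eqVneq (enorm (Defs.proj x) * enorm y) 0; first by rewrite invr0 mulr0.
by rewrite ler_pdivrMr ?mul1r ?cauchy_schwarz// lt_def x0 mulr_ge0 ?enorm_ge0.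
Qed.

(** For [Defs.proj x = 0] both sides vanish, thanks to [x / 0 = 0]. *)
Lemma sin_theta_cos_theta' x y : half_space x ->
  sin (theta x) * cos (theta' x y) = dot (Defs.proj x) y / (enorm x * enorm y).
Proof.
move=> hx; rewrite sin_theta// cos_theta'.
have [p0|p0] := eqVneq (enorm (Defs.proj x)) 0; last first.
  rewrite !invfM -[RHS]mul1r -(divff p0); ring.
by rewrite p0 !mul0r (enorm_eq0 p0) /dot big1 ?mul0r// => i _; rewrite mxE mul0r.
Qed.

End geometry.

(** * Upper bound for the kernel *)

Section kernel_estimates.
Context {R : realType}.

Lemma sqr_powR (a s : R) : 0 <= a -> (a ^+ 2) `^ s = a `^ (2 * s).
Proof. by move=> a0; rewrite -powR_mulrn// -powRrM. Qed.

Lemma powR_nD (a s : R) n : 0 < a -> a `^ (n%:R + s) = a ^+ n * a `^ s.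
Proof.
move=> a0; rewrite powRD; first by rewrite powR_mulrn// ltW.
by rewrite (gt_eqF a0) implybT.
Qed.

Lemma powRN_le (a b s : R) : 0 < a -> a <= b -> 0 <= s -> b `^ (- s) <= a `^ (- s).
Proof.
move=> a0 ab s0; have b0 := lt_le_trans a0 ab.
rewrite !powRN lef_pV2 ?posrE ?powR_gt0// ge0_ler_powR// nnegrE ltW//.
Qed.

Lemma powRN_le_shift (e u a s : R) : 0 < e -> e <= u -> 0 <= s -> s <= a ->
  u `^ (- a) <= (1 + e^-1) `^ a * (1 + u) `^ (- s).
Proof.
move=> e0 eu s0 sa; have u0 := lt_le_trans e0 eu.
have ei : 0 < e^-1 by rewrite invr_gt0.
have uu : 1 + u <= (1 + e^-1) * u.
  have : 1 <= e^-1 * u by rewrite mulrC ler_pdivlMr// mul1r.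
  lra.
have us0 : 0 < (1 + u) `^ s by rewrite powR_gt0//; lra.
rewrite !powRN ler_pdivlMr// mulrC ler_pdivrMr ?powR_gt0//.
apply: (@le_trans _ _ ((1 + u) `^ a)); first by rewrite ler_powR//; lra.
rewrite -powRM; [|lra|lra].
by rewrite ge0_ler_powR ?nnegrE; lra.
Qed.

Variables (l : R) (M d : nat).
Hypothesis l0 : 0 < l.
Implicit Types (x : 'rV[R]_d.+1) (y : 'rV[R]_d).

Lemma omegaE x : omega l M x = enorm x ^+ M * (enorm x / x 0 ord_max) `^ (2 * l).
Proof. by rewrite /omega cos_theta invf_div. Qed.

Lemma enorm_pow_le_omega x : half_space x -> enorm x ^+ M <= omega l M x.
Proof.
move=> hx; rewrite omegaE ler_peMr ?exprn_ge0 ?enorm_ge0//.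
rewrite -[leLHS](powRr0 (enorm x / x 0 ord_max)) ler_powR ?mulr_ge0 ?(ltW l0)//.
by rewrite ler_pdivlMr// mul1r height_le_enorm.
Qed.

Lemma omega_gt0 x : half_space x -> 0 < omega l M x.
Proof.
move=> hx; apply: lt_le_trans (enorm_pow_le_omega hx).
by rewrite exprn_gt0// half_space_enorm.
Qed.

(** The variables [u] and [t] in which the kernel is a Taylor remainder. *)
Definition ratio x y := enorm x / enorm y.
Definition cosine x y := dot (Defs.proj x) y / (enorm x * enorm y).

Lemma cosine_le1 x y : half_space x -> 0 < enorm y -> `|cosine x y| <= 1.
Proof.
move=> hx y0; have x0 := half_space_enorm hx.
have xy0 : 0 < enorm x * enorm y by rewrite mulr_gt0.
rewrite /cosine normrM normfV (gtr0_norm xy0) ler_pdivrMr// mul1r.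
by apply: le_trans (cauchy_schwarz _ _) _; rewrite ler_pM2r// enorm_proj_le.
Qed.

Lemma dist_sqrE x y : enorm (y - Defs.proj x) ^+ 2 + x 0 ord_max ^+ 2 =
  enorm y ^+ 2 - 2 * dot (Defs.proj x) y + enorm x ^+ 2.
Proof.
rewrite enorm_proj -!dotvv dotBl ![dot _ (_ - _)]dotC !dotBl (dotC y); ring.
Qed.

Lemma dist_sqr_ratioE x y : half_space x -> 0 < enorm y ->
  enorm (y - Defs.proj x) ^+ 2 + x 0 ord_max ^+ 2 =
  enorm y ^+ 2 * (1 - 2 * cosine x y * ratio x y + ratio x y ^+ 2).
Proof.
move=> hx y0; have x0 := half_space_enorm hx.
by rewrite dist_sqrE /cosine /ratio; field; rewrite !gt_eqF.
Qed.

Lemma KM_E x y : half_space x -> 0 < enorm y ->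
  KM l M x y = enorm y `^ (- (2 * l)) *
    ((1 - 2 * cosine x y * ratio x y + ratio x y ^+ 2) `^ (- l) -
     \sum_(m < M) ratio x y ^+ m * (gegenbauer l m).[cosine x y]).
Proof.
move=> hx y0; rewrite /KM /K dist_sqr_ratioE// powRM ?sqr_ge0//; last first.
  rewrite -(pmulr_rge0 _ (exprn_gt0 2 y0)) -dist_sqr_ratioE//.
  by rewrite addr_ge0// sqr_ge0.
rewrite sqr_powR ?enorm_ge0// mulrN mulrBr mulr_sumr; congr (_ - _).
apply: eq_bigr => m _; rewrite sin_theta_cos_theta'// mulrA; congr (_ * _).
by rewrite /ratio expr_div_n powR_nD// powRN invfM; ring.
Qed.

Lemma K_le x y : half_space x -> K l x y <= x 0 ord_max `^ (- (2 * l)).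
Proof.
move=> hx; rewrite -mulrN -sqr_powR ?(ltW hx)//.
apply: powRN_le; [exact: exprn_gt0|by rewrite lerDr sqr_ge0|exact: ltW].
Qed.

Lemma gegenbauer_sum_le x y : half_space x -> 0 < enorm y ->
  `|\sum_(m < M) enorm x ^+ m / enorm y `^ (m%:R + 2 * l) *
     (gegenbauer l m).[sin (theta x) * cos (theta' x y)]| <=
  enorm y `^ (- (2 * l)) * \sum_(m < M) (gegenbauer_rate l * ratio x y) ^+ m.
Proof.
move=> hx y0; have x0 := half_space_enorm hx.
apply: le_trans (ler_norm_sum _ _ _) _; rewrite mulr_sumr; apply: ler_sum => m _.
rewrite sin_theta_cos_theta'// normrM (@ger0_norm _ (_ / _)); last first.
  by rewrite divr_ge0 ?exprn_ge0 ?enorm_ge0 ?powR_ge0.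
rewrite powR_nD// powRN exprMn /ratio expr_div_n.
rewrite [leRHS](_ : _ = (enorm y `^ (2 * l))^-1 * (enorm x ^+ m / enorm y ^+ m *
  gegenbauer_rate l ^+ m)); last by ring.
rewrite [leLHS](_ : _ = (enorm y `^ (2 * l))^-1 * (enorm x ^+ m / enorm y ^+ m *
  `|(gegenbauer l m).[cosine x y]|)); last by rewrite invfM /cosine; ring.
rewrite ler_wpM2l ?invr_ge0 ?powR_ge0// ler_wpM2l//.
  by rewrite divr_ge0 ?exprn_ge0 ?enorm_ge0.
exact: gegenbauer_le (cosine_le1 hx y0).
Qed.

Let p := M%:R + 2 * l.

(** The factor [(1 + ratio x y) ^ (- s)] is what later makes the operator
    [o(omega)] and not merely [O(omega)]. *)
Lemma KM_le : exists2 C, 0 < C & forall x y, half_space x -> 0 < enorm y ->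
  `|KM l M x y| <= C * omega l M x * enorm y `^ (- p) *
                   (1 + ratio x y) `^ (- Num.min 1 (2 * l)).
Proof.
set s := Num.min 1 (2 * l).
have ll : 0 < l := l0.
have s0 : 0 <= s by rewrite /s le_min; lra.
set B := gegenbauer_rate l; have B1 : 1 < B by rewrite /B /gegenbauer_rate; lra.
pose e := (8 * B)^-1.
have e0 : 0 < e by rewrite /e invr_gt0; lra.
have eB : e * (8 * B) = 1 by rewrite /e mulVf// gt_eqF//; lra.
pose k := 1 + e^-1.
pose C1 := 2 * B ^+ M * (1 + e) `^ s.
pose C2 := k `^ p + \sum_(m < M) B ^+ m * k `^ (M - m)%:R.
have C10 : 0 < C1 by rewrite /C1 mulr_gt0 ?powR_gt0 ?mulr_gt0 ?exprn_gt0//; lra.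
have k0 : 0 < k by rewrite /k ltr_pwDl// invr_ge0 ltW.
have C20 : 0 < C2.
  rewrite /C2 ltr_pwDl ?powR_gt0// sumr_ge0// => i _.
  by rewrite mulr_ge0 ?powR_ge0// exprn_ge0//; lra.
exists (C1 + C2) => [|x y hx y0]; first by rewrite addr_gt0.
have x0 := half_space_enorm hx; have w0 := omega_gt0 hx.
have u0 : 0 < ratio x y by rewrite divr_gt0.
have t1 := cosine_le1 hx y0.
have yp : 0 < enorm y `^ (- p) by rewrite powR_gt0.
have xE : enorm x = ratio x y * enorm y by rewrite divfK// gt_eqF.
have yM : enorm y `^ (- (2 * l)) = enorm y ^+ M * enorm y `^ (- p).
  rewrite -powR_nD//; congr (_ `^ _); rewrite /p; ring.
set g := (1 + _) `^ _.
have g0 : 0 < g by rewrite powR_gt0; lra.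
have [ue|eu] := leP (ratio x y) e.
  (* Small ratio: Taylor remainder; the decay factor is bounded below. *)
  apply: (@le_trans _ _ (C1 * omega l M x * enorm y `^ (- p) * g)); last first.
    by rewrite !ler_pM2r// lerDl ltW.
  rewrite KM_E// normrM (gtr0_norm (powR_gt0 _ y0)).
  have uB : ratio x y * (4 * B) < 1 by nra.
  apply: le_trans (ler_wpM2l _ (@gegenbauer_remainder _ _ _ _ M l0 t1 (ltW u0) uB)) _.
    by rewrite powR_ge0.
  rewrite -/B yM exprMn.
  have ge1 : 1 <= (1 + e) `^ s * g.
    rewrite /g powRN -ler_pdivrMr ?invr_gt0 ?powR_gt0; last lra.
      by rewrite invrK mul1r ge0_ler_powR ?nnegrE; lra.
    lra.
  rewrite [leLHS](_ : _ = 2 * B ^+ M * enorm y `^ (- p) * enorm x ^+ M); last first.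
    by rewrite xE !exprMn; ring.
  rewrite [leRHS](_ : _ = 2 * B ^+ M * enorm y `^ (- p) *
    (omega l M x * ((1 + e) `^ s * g))); last by rewrite /C1; ring.
  rewrite ler_pM2l; last by rewrite !mulr_gt0// exprn_gt0//; lra.
  apply: le_trans (enorm_pow_le_omega hx) _.
  by rewrite ler_peMr// ltW.
(* Large ratio: the kernel and the subtracted sum are estimated separately. *)
have ps : s <= p.
  by rewrite /s /p ge_min; apply/orP; right; rewrite lerDr.
have hK : `|K l x y| <= k `^ p * omega l M x * enorm y `^ (- p) * g.
  rewrite ger0_norm ?powR_ge0//; apply: le_trans (K_le y hx) _.
  have -> : x 0 ord_max `^ (- (2 * l)) =
      omega l M x * enorm y `^ (- p) * ratio x y `^ (- p).
    have xp : enorm y `^ (- p) * ratio x y `^ (- p) = enorm x `^ (- p).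
      by rewrite -powRM ?(ltW y0) ?(ltW u0)// mulrC -xE.
    have h0 : 0 < x 0 ord_max := hx.
    rewrite -mulrA xp omegaE powRM ?(ltW x0) ?invr_ge0 ?(ltW h0)//.
    rewrite -powR_inv1 ?(ltW h0)// -powRrM mulN1r !powRN /p powR_nD//.
    have r1 : 0 < enorm x `^ (2 * l) by rewrite powR_gt0.
    by field; rewrite !gt_eqF ?powR_gt0 ?exprn_gt0.
  rewrite [leRHS](_ : _ = omega l M x * enorm y `^ (- p) * (k `^ p * g)); last by ring.
  rewrite ler_pM2l; last by rewrite mulr_gt0.
  by apply: powRN_le_shift => //; exact: ltW.
apply: (@le_trans _ _ (C2 * omega l M x * enorm y `^ (- p) * g)); last first.
  by rewrite !ler_pM2r// lerDr ltW.
apply: le_trans (ler_normB _ _) _.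
rewrite /C2 [leRHS](_ : _ = k `^ p * omega l M x * enorm y `^ (- p) * g +
  (\sum_(m < M) B ^+ m * k `^ (M - m)%:R) * omega l M x * enorm y `^ (- p) * g); last by ring.
apply: lerD => //; apply: le_trans (gegenbauer_sum_le hx y0) _.
rewrite -/B mulr_sumr !mulr_suml; apply: ler_sum => m _.
have uMm : ratio x y `^ (- (M - m)%:R) <= k `^ (M - m)%:R * g.
  apply: powRN_le_shift => //; first exact: ltW.
  by rewrite /s ge_min ler1n subn_gt0 ltn_ord.
have um : ratio x y ^+ m = ratio x y ^+ M * ratio x y `^ (- (M - m)%:R).
  rewrite powR_invn ?(ltW u0)// -{2}(subnKC (ltnW (ltn_ord m))) exprD mulfK//.
  by rewrite expf_neq0// gt_eqF.
rewrite exprMn um yM.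
rewrite [leLHS](_ : _ = enorm y `^ (- p) * B ^+ m *
  (enorm x ^+ M * ratio x y `^ (- (M - m)%:R))); last by rewrite xE !exprMn; ring.
rewrite [leRHS](_ : _ = enorm y `^ (- p) * B ^+ m *
  (omega l M x * (k `^ (M - m)%:R * g))); last by ring.
rewrite ler_pM2l; last by rewrite mulr_gt0// exprn_gt0//; lra.
by rewrite ler_pM ?exprn_ge0 ?enorm_ge0 ?powR_ge0 ?enorm_pow_le_omega.
Qed.

End kernel_estimates.

(** * Lower bound for the kernel *)

Lemma exists_unit_dot (R : realType) d (v : 'rV[R]_d) : (0 < d)%N ->
  exists2 e : 'rV[R]_d, enorm e = 1 & dot v e = enorm v.
Proof.
case: d v => // d v _; have [v0|v0] := eqVneq (enorm v) 0.
  exists (delta_mx 0 ord0).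
    rewrite /enorm /dot (bigD1 ord0)//= big1 ?addr0 ?mxE ?eqxx ?mulr1 ?sqrtr1//.
    by move=> i /negPf i0; rewrite mxE eqxx i0 mulr0.
  by rewrite v0 (enorm_eq0 v0) /dot big1// => i _; rewrite mxE mul0r.
have vp : 0 < enorm v by rewrite lt_def v0 enorm_ge0.
exists ((enorm v)^-1 *: v).
  by rewrite enormZ ?invr_ge0 ?enorm_ge0// mulVf.
by rewrite dotC dotZl dotvv expr2 mulKf.
Qed.

Lemma powR_le (R : realType) (a b s : R) : 0 <= s -> 0 <= a -> a <= b ->
  a `^ s <= b `^ s.
Proof.
by move=> s0 a0 ab; rewrite ge0_ler_powR// nnegrE// (le_trans a0).
Qed.

Section kernel_lower_bound.
Context {R : realType}.
Variables (l : R) (M d : nat).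
Hypothesis l0 : 0 < l.
Implicit Types (x : 'rV[R]_d.+1) (y : 'rV[R]_d).
Let p := M%:R + 2 * l.

(** Near the boundary the singularity of [K] dominates the subtracted sum, whose
    terms are bounded at the foot [Defs.proj x] since there the ratio is at
    most 2. *)
Lemma KM_ge_grazing : exists k c : R, [/\ 0 < k, 0 < c & forall x, half_space x ->
  x 0 ord_max < k * enorm x ->
  enorm x / 2 <= enorm (Defs.proj x) /\
  c * omega l M x * enorm (Defs.proj x) `^ (- p) <= `|KM l M x (Defs.proj x)| ].
Proof.
have ll : 0 < l := l0.
set B := gegenbauer_rate l; have B1 : 1 < B by rewrite /B /gegenbauer_rate; lra.
pose D := \sum_(m < M) (2 * B) ^+ m.
have D0 : 0 <= D by apply: sumr_ge0 => m _; rewrite exprn_ge0//; lra.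
have D1 : 0 < 2 * D + 1 by lra.
(* [k1] is chosen so that [k1 ^ (- 2 l) = 2 D + 1], which beats the sum [D]. *)
pose k1 := (2 * D + 1) `^ (- (2 * l)^-1).
have k10 : 0 < k1 by rewrite powR_gt0.
have k11 : k1 <= 1.
  by rewrite /k1 -[leRHS](powRr0 (2 * D + 1)) ler_powR ?oppr_le0 ?invr_ge0; lra.
have k1l : k1 `^ (2 * l) = (2 * D + 1)^-1.
  by rewrite /k1 -powRrM mulNr mulVf ?powR_inv1 ?(ltW D1)// gt_eqF//; lra.
exists (k1 / 2), (2 `^ (- (2 * l)) / (2 * 2 ^+ M)); split.
- by rewrite divr_gt0.
- by rewrite divr_gt0 ?powR_gt0// mulr_gt0// exprn_gt0.
move=> x hx xk; have x0 := half_space_enorm hx.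
have h0 : 0 < x 0 ord_max := hx.
set y := Defs.proj x.
have yx : enorm x / 2 <= enorm y.
  have := enorm_proj x; rewrite -/y => xy.
  have h12 : x 0 ord_max <= enorm x / 2.
    by apply: le_trans (ltW xk) _; nra.
  rewrite -(@ler_pXn2r _ 2)// ?nnegrE ?enorm_ge0 ?divr_ge0 ?(ltW x0)//.
  nra.
split=> //.
have y0 : 0 < enorm y by lra.
have S0 : 0 < (enorm x / x 0 ord_max) `^ (2 * l) by apply: powR_gt0; exact: divr_gt0.
have KS : enorm y `^ (- (2 * l)) * (2 `^ (- (2 * l)) * (enorm x / x 0 ord_max) `^ (2 * l))
    <= K l x y.
  rewrite /K subrr.
  have -> : enorm (0 : 'rV[R]_d) = 0.
    by rewrite /enorm /dot big1 ?sqrtr0// => i _; rewrite mxE mul0r.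
  rewrite expr0n/= add0r sqr_powR ?(ltW h0)// mulrN.
  have -> : x 0 ord_max `^ (- (2 * l)) =
     enorm y `^ (- (2 * l)) * (2 `^ (- (2 * l)) * (2 * enorm y / x 0 ord_max) `^ (2 * l)).
    rewrite powRM ?invr_ge0 ?mulr_ge0 ?(ltW y0) ?(ltW h0)//.
    rewrite powRM ?(ltW y0)//.
    rewrite -(powR_inv1 (ltW h0)) -powRrM mulN1r !powRN.
    by field; rewrite !gt_eqF ?powR_gt0.
  rewrite ler_pM2l ?powR_gt0// ler_pM2l ?powR_gt0//.
  apply: powR_le; [lra|by rewrite divr_ge0// ltW|].
  by rewrite ler_pM2r ?invr_gt0//; lra.
have SD : 2 * D <= 2 `^ (- (2 * l)) * (enorm x / x 0 ord_max) `^ (2 * l).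
  have : (2 * k1^-1) `^ (2 * l) <= (enorm x / x 0 ord_max) `^ (2 * l).
    apply: powR_le; [lra|by rewrite mulr_ge0// invr_ge0 ltW|].
    rewrite ler_pdivlMr// mulrAC ler_pdivrMr//; lra.
  have -> : (2 * k1^-1) `^ (2 * l) = 2 `^ (2 * l) * (2 * D + 1).
    rewrite powRM ?invr_ge0 ?(ltW k10)//; congr (_ * _).
    by rewrite -(powR_inv1 (ltW k10)) -powRrM mulN1r powRN k1l invrK.
  have t0 : 0 < 2 `^ (2 * l) :> R by rewrite powR_gt0.
  move=> h; rewrite powRN [leRHS]mulrC ler_pdivlMr//.
  by apply: le_trans h; rewrite mulrC ler_pM2l//; lra.
have rem : `|K l x y - KM l M x y| <= enorm y `^ (- (2 * l)) * D.
  rewrite /KM subKr; apply: le_trans (gegenbauer_sum_le M l0 hx y0) _.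
  rewrite ler_pM2l ?powR_gt0//; apply: ler_sum => m _.
  have r2 : ratio x y <= 2 by rewrite /ratio ler_pdivrMr//; lra.
  have r0 : 0 <= ratio x y by rewrite /ratio divr_ge0 ?enorm_ge0.
  have B0 : 0 < B by lra.
  have bu2 : B * ratio x y <= 2 * B by rewrite mulrC ler_pM2r.
  have bu0 : 0 <= B * ratio x y by rewrite mulr_ge0// ltW.
  by rewrite lerXn2r ?nnegrE// (le_trans bu0).
have yM : (enorm x / 2) ^+ M * enorm y `^ (- p) <= enorm y `^ (- (2 * l)).
  have -> : enorm y `^ (- (2 * l)) = enorm y ^+ M * enorm y `^ (- p).
    by rewrite -powR_nD//; congr (_ `^ _); rewrite /p; ring.
  by rewrite ler_pM2r ?powR_gt0// lerXn2r ?nnegrE ?divr_ge0 ?enorm_ge0.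
set S := 2 `^ _ * _ `^ _ in KS SD.
have Y0 : 0 < enorm y `^ (- (2 * l)) by rewrite powR_gt0.
have KMS : enorm y `^ (- (2 * l)) * (S / 2) <= `|KM l M x y|.
  apply: le_trans (ler_norm _).
  have := le_trans (ler_norm _) rem; have := ler_wpM2l (ltW Y0) SD.
  by move: KS; lra.
apply: le_trans KMS.
rewrite omegaE [leLHS](_ : _ = ((enorm x / 2) ^+ M * enorm y `^ (- p)) * (S / 2)); last first.
  by rewrite /S expr_div_n; field; rewrite expf_neq0.
by rewrite ler_wpM2r// divr_ge0// mulr_ge0 ?powR_ge0.
Qed.

(** Away from the boundary [omega] is comparable to [enorm x ^+ M], so that
    [gegenbauer_remainder_ge] suffices: take [y] in the direction of the
    projection of [x], at a distance that makes the ratio equal to the [u]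
    provided there. *)
Lemma KM_ge_transversal (k : R) : (0 < d)%N -> 0 < k ->
  exists2 c : R, 0 < c & forall x, half_space x -> k * enorm x <= x 0 ord_max ->
  exists2 y, enorm x <= enorm y &
    c * omega l M x * enorm y `^ (- p) <= `|KM l M x y|.
Proof.
move=> d0 k0; have ll : 0 < l := l0.
have [e [c [e0 e1 c0 hc]]] := @gegenbauer_remainder_ge _ l M l0.
exists (c * k `^ (2 * l)) => [|x hx kx]; first by rewrite mulr_gt0 ?powR_gt0.
have x0 := half_space_enorm hx; have h0 : 0 < x 0 ord_max := hx.
have [v v1 xv] := exists_unit_dot (Defs.proj x) d0.
have t1 : `|enorm (Defs.proj x) / enorm x| <= 1.
  by rewrite ger0_norm ?divr_ge0 ?enorm_ge0// ler_pdivrMr// mul1r enorm_proj_le.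
have [u ue hu] := hc _ t1.
have [u0 u1] : 0 < u /\ u <= 1 by case/orP: ue => /eqP ->; lra.
pose y := (enorm x / u) *: v.
have yE : enorm y = enorm x / u by rewrite enormZ ?v1 ?mulr1// divr_ge0// ltW.
have y0 : 0 < enorm y by rewrite yE divr_gt0.
exists y; first by rewrite yE ler_pdivlMr// ler_piMr// ltW.
have rE : ratio x y = u by rewrite /ratio yE invf_div mulrC divfK// gt_eqF.
have tE : cosine x y = enorm (Defs.proj x) / enorm x.
  rewrite /cosine dotC dotZl dotC xv yE.
  by field; rewrite !gt_eqF.
rewrite KM_E// rE tE normrM (gtr0_norm (powR_gt0 _ y0)).
have -> : enorm y `^ (- (2 * l)) = enorm y ^+ M * enorm y `^ (- p).
  by rewrite -powR_nD//; congr (_ `^ _); rewrite /p; ring.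
rewrite [leLHS]mulrC (mulrC (enorm y ^+ M)) -[leRHS]mulrA ler_pM2l ?powR_gt0//.
apply: le_trans (ler_wpM2l _ hu); last by rewrite exprn_ge0 ?enorm_ge0.
rewrite [leRHS]mulrCA -exprMn yE divfK ?gt_eqF//.
rewrite omegaE [leLHS](_ : _ = c * enorm x ^+ M *
  (k `^ (2 * l) * (enorm x / x 0 ord_max) `^ (2 * l))); last by ring.
rewrite ler_piMr ?mulr_ge0 ?exprn_ge0 ?(ltW x0) ?(ltW c0)//.
rewrite -powRM ?(ltW k0) ?divr_ge0 ?(ltW x0) ?(ltW h0)//.
apply: (@le_trans _ _ (1 `^ (2 * l))); last by rewrite powR1.
apply: powR_le; [lra| |].
  by rewrite mulr_ge0 ?divr_ge0 ?(ltW x0) ?(ltW h0) ?(ltW k0).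
by rewrite mulrA ler_pdivrMr// mul1r.
Qed.

Lemma KM_ge : (0 < d)%N -> exists2 c : R, 0 < c & forall x, half_space x ->
  2 < enorm x -> exists y, [/\ 1 < enorm y, enorm x / 2 <= enorm y &
    c * omega l M x * enorm y `^ (- p) <= `|KM l M x y|].
Proof.
move=> d0; have [k [c1 [k0 c10 h1]]] := KM_ge_grazing.
have [c2 c20 h2] := KM_ge_transversal d0 k0.
exists (Num.min c1 c2) => [|x hx x2]; first by rewrite lt_min c10.
have w0 := omega_gt0 M l0 hx.
have cle c y : Num.min c1 c2 <= c -> c * omega l M x * enorm y `^ (- p) <= `|KM l M x y| ->
    Num.min c1 c2 * omega l M x * enorm y `^ (- p) <= `|KM l M x y|.
  move=> cc; apply: le_trans; rewrite ler_wpM2r ?powR_ge0// ler_wpM2r//.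
  exact: ltW.
have [xk|kx] := ltP (x 0 ord_max) (k * enorm x).
  have [yx hy] := h1 x hx xk; exists (Defs.proj x); split => //; first lra.
  by apply: cle hy; rewrite ge_min lexx.
have [y xy hy] := h2 x hx kx; exists y; split; [lra|lra|].
by apply: cle hy; rewrite ge_min lexx orbT.
Qed.

End kernel_lower_bound.

(** * Measurability and the weight *)

Section measurability.
Context {R : realType}.

Lemma measurable_lebesgue d (A : set 'rV[R]_d) :
  measurable A -> measurable (A : set (lebesgue_type R d)).
Proof. exact: caratheodory_measurable_mu_ext. Qed.

Lemma lebesgue_rV_borel d (A : set 'rV[R]_d) :
  measurable A -> lebesgue_rV d A = borel_lebesgue_rV d A.
Proof. by move=> mA; exact: measurable_mu_extE. Qed.

Lemma measurable_fun_lebesgue d (f : 'rV[R]_d -> R) :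
  measurable_fun [set: 'rV[R]_d] f ->
  measurable_fun [set: lebesgue_type R d] (f : lebesgue_type R d -> R).
Proof.
move=> mf _ B mB; rewrite setTI; apply: measurable_lebesgue.
by rewrite -[X in measurable X]setTI; exact: mf.
Qed.

Lemma measurable_dotr d (u : 'rV[R]_d) : measurable_fun [set: 'rV[R]_d] (dot u).
Proof.
apply: measurable_sum => i; apply: measurable_funM; first exact: measurable_cst.
exact: measurable_coord.
Qed.

Lemma measurable_enorm d : measurable_fun [set: 'rV[R]_d] (@enorm R d).
Proof.
apply: measurableT_comp.
  by apply: continuous_measurable_fun; exact: sqrt_continuous.
by apply: measurable_sum => i; apply: measurable_funM; exact: measurable_coord.
Qed.

Lemma measurable_enorm_powR d (s : R) :
  measurable_fun [set: 'rV[R]_d] (fun y => enorm y `^ s).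
Proof.
by apply: (measurableT_comp (measurable_powR s)); exact: measurable_enorm.
Qed.

(** Without trigonometric functions the regularity of the kernel in [y] is
    visible. *)
Lemma KM_explicit (l : R) M d (x : 'rV[R]_d.+1) : half_space x -> KM l M x = fun y =>
  (enorm y ^+ 2 - 2 * dot (Defs.proj x) y + enorm x ^+ 2) `^ (- l)
   - \sum_(m < M) enorm x ^+ m * enorm y `^ (- (m%:R + 2 * l)) *
     (gegenbauer l m).[dot (Defs.proj x) y * ((enorm x)^-1 * enorm y `^ (-1))].
Proof.
move=> hx; apply/funext => y; rewrite /KM /K dist_sqrE; congr (_ - _); apply: eq_bigr => m _.
by rewrite sin_theta_cos_theta'// powRN powR_inv1 ?enorm_ge0// invfM.
Qed.

Lemma measurable_KM (l : R) M d (x : 'rV[R]_d.+1) : half_space x ->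
  measurable_fun [set: 'rV[R]_d] (KM l M x).
Proof.
move=> hx; rewrite KM_explicit//.
have md := @measurable_dotr d (Defs.proj x).
apply: measurable_funB.
  apply: (measurableT_comp (measurable_powR _)); apply: measurable_funD => //.
  apply: measurable_funB; last exact: measurable_funM.
  by apply: measurable_funX; exact: measurable_enorm.
apply: measurable_sum => m; apply: measurable_funM.
  by apply: measurable_funM => //; exact: measurable_enorm_powR.
apply: measurableT_comp; first exact: measurable_poly.
apply: measurable_funM => //; apply: measurable_funM => //.
exact: measurable_enorm_powR.
Qed.

Lemma enorm_continuous d : continuous (@enorm R d).
Proof.
move=> y; apply: (@continuous_comp _ _ _ (fun u => dot u u) Num.sqrt).
  2: exact: sqrt_continuous.
apply: continuous_big => [|i _ u]; last first.
  have c : u' 0 i @[u' --> u] --> u 0 i := @coord_continuous R 1 d 0 i u.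
  exact: (cvgM c c).
exact: add_continuous.
Qed.

End measurability.

Section weighted_integrals.
Context {R : realType}.
Variables (l : R) (M d : nat).
Hypothesis l0 : 0 < l.
Implicit Types (x : 'rV[R]_d.+1) (y : 'rV[R]_d).
Let p := M%:R + 2 * l.

Definition weight y : R := (enorm y `^ (M%:R + 2 * l) + 1)^-1.

Lemma weight_gt0 y : 0 < weight y.
Proof. by rewrite invr_gt0 ltr_wpDl// powR_ge0. Qed.

Lemma weight_le y : 0 < enorm y -> weight y <= enorm y `^ (- p).
Proof.
by move=> y0; rewrite powRN lef_pV2 ?posrE ?powR_gt0 ?ltr_wpDl ?powR_ge0// lerDl.
Qed.

Lemma le_weight y : 1 < enorm y -> enorm y `^ (- p) <= 2 * weight y.
Proof.
move=> y1; have y0 : 0 < enorm y by lra.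
have p1 : 1 <= enorm y `^ p.
  rewrite -(powRr0 (enorm y)) ler_powR ?(ltW y1)//.
  by rewrite /p addr_ge0// mulr_ge0// ltW.
rewrite powRN /weight -/p ler_pdivlMr; last lra.
by rewrite mulrC ler_pdivrMr; lra.
Qed.

Lemma KM_le_weight : exists2 C, 0 < C & forall x y, half_space x -> 1 < enorm y ->
  `|KM l M x y| <= C * omega l M x * weight y *
                   (1 + ratio x y) `^ (- Num.min 1 (2 * l)).
Proof.
have [C C0 hC] := KM_le M d l0; exists (2 * C) => [|x y hx y1]; first by rewrite mulr_gt0.
have y0 : 0 < enorm y by lra.
apply: le_trans (hC x y hx y0) _; rewrite ler_wpM2r ?powR_ge0//.
rewrite [leRHS](_ : _ = C * omega l M x * (2 * weight y)); last by ring.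
by rewrite ler_wpM2l ?le_weight// mulr_ge0 ?(ltW C0) ?(ltW (omega_gt0 M l0 hx)).
Qed.

Definition far : set (lebesgue_type R d) := [set y | 1 < @enorm R d y].

Lemma measurable_far : measurable far.
Proof.
suff -> : far = setT `&` (@enorm R d) @^-1` `]1, +oo[.
  by apply: measurable_lebesgue; exact: measurable_enorm.
by apply/seteqP; split=> y /=; rewrite in_itv/= andbT => //; case.
Qed.

Lemma measurable_weight :
  measurable_fun [set: lebesgue_type R d] (weight : lebesgue_type R d -> R).
Proof.
apply: measurable_fun_lebesgue.
rewrite (_ : weight = fun y => (enorm y `^ p + 1) `^ (-1)).
  apply: (measurableT_comp (measurable_powR _)); apply: measurable_funD => //.
  exact: measurable_enorm_powR.
by apply/funext => y; rewrite powR_inv1// addr_ge0 ?powR_ge0.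
Qed.

End weighted_integrals.

(** * Integral operators on a weighted space *)

(** Signs can be chosen one after the other so that no diagonal term of a
    triangular array is cancelled by the preceding terms of its row. *)
Fixpoint sign_list (R : realType) (a : nat -> nat -> R) (n : nat) : seq R :=
  if n is m.+1 then
    let s := sign_list a m in
    rcons s (if 0 <= (\sum_(j < m) s`_j * a m j) * a m m then 1 else -1)
  else [::].

Lemma size_sign_list (R : realType) (a : nat -> nat -> R) n : size (sign_list a n) = n.
Proof. by elim: n => //= n IH; rewrite size_rcons IH. Qed.

Lemma exists_signs (R : realType) (a : nat -> nat -> R) :
  exists s : nat -> R, (forall j, `|s j| = 1) /\
    forall n, `|a n n| <= `|\sum_(j < n.+1) s j * a n j|.
Proof.
exists (fun j => (sign_list a j.+1)`_j).
have nthE n j : (j < n)%N -> (sign_list a n)`_j = (sign_list a j.+1)`_j.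
  elim: n => // n IH; rewrite ltnS leq_eqVlt => /predU1P[->//|jn].
  by rewrite /= nth_rcons size_sign_list jn IH.
split=> [j|n].
  by rewrite /= nth_rcons size_sign_list ltnn eqxx; case: ifP; rewrite ?normrN normr1.
rewrite big_ord_recr/= nth_rcons size_sign_list ltnn eqxx.
set S := \sum_(j < n) _.
have -> : \sum_(j < n) (sign_list a n)`_j * a n j = S.
  by apply: eq_bigr => j _; rewrite nthE.
have [Sa|Sa] := leP 0 (S * a n n).
  rewrite mul1r -ler_sqr ?nnegrE// !real_normK ?num_real// sqrrD.
  have := sqr_ge0 S; lra.
rewrite mulN1r -ler_sqr ?nnegrE// !real_normK ?num_real// sqrrB.
have := sqr_ge0 S; lra.
Qed.

Section weighted_kernel.
Context d (T : measurableType d) (R : realType) (mu : {measure set T -> \bar R}).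
Variables (D : set T) (w : T -> R).
Hypotheses (mD : measurable D) (mw : measurable_fun [set: T] w) (w0 : forall y, 0 < w y).
Implicit Types f g k : T -> R.

Definition wnorm f : \bar R := (\int[mu]_y (`|f y| * w y)%:E)%E.

Definition kernel_integral k f : \bar R := (\int[mu]_(y in D) (f y * k y)%:E)%E.

Lemma measurable_wnorm_fun f : measurable_fun [set: T] f ->
  measurable_fun [set: T] (fun y => (`|f y| * w y)%:E).
Proof.
move=> mf; apply/measurable_EFinP/measurable_funM => //.
exact: measurableT_comp.
Qed.

Lemma measurable_kernel_fun k f : measurable_fun [set: T] k ->
  measurable_fun [set: T] f -> measurable_fun D (fun y => (f y * k y)%:E).
Proof.
by move=> mk mf; apply/measurable_EFinP/measurable_funTS/measurable_funM.
Qed.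

Lemma abs_kernel_le k f (C : R) : measurable_fun [set: T] k ->
  measurable_fun [set: T] f -> 0 <= C -> (forall y, D y -> `|k y| <= C * w y) ->
  (\int[mu]_(y in D) `|(f y * k y)%:E| <= C%:E * wnorm f)%E.
Proof.
move=> mk mf C0 kC.
have fw0 y : (0 <= (`|f y| * w y)%:E)%E by rewrite lee_fin mulr_ge0// ltW.
have mfw := measurable_wnorm_fun mf.
rewrite /wnorm -ge0_integralZl_EFin//.
apply: (@le_trans _ _ (\int[mu]_(y in D) (C%:E * (`|f y| * w y)%:E))%E).
  apply: ge0_le_integral => //.
  - by apply: measurableT_comp => //; exact: measurable_kernel_fun.
  - by apply: measurable_funeM; exact: measurable_funTS.
  - by move=> y Dy; rewrite /= -EFinM lee_fin normrM mulrCA ler_wpM2l// kC.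
apply: ge0_subset_integral => //; first exact: measurable_funeM.
by move=> y _; rewrite mule_ge0.
Qed.

Lemma integrable_kernel k f (C : R) : measurable_fun [set: T] k ->
  measurable_fun [set: T] f -> 0 <= C -> (forall y, D y -> `|k y| <= C * w y) ->
  (wnorm f < +oo)%E -> mu.-integrable D (fun y => (f y * k y)%:E).
Proof.
move=> mk mf C0 kC ff; apply/integrableP; split; first exact: measurable_kernel_fun.
apply: le_lt_trans (abs_kernel_le mk mf C0 kC) _.
by rewrite lte_mul_pinfty.
Qed.

Lemma kernel_integral_le k f (C : R) : measurable_fun [set: T] k ->
  measurable_fun [set: T] f -> 0 <= C -> (forall y, D y -> `|k y| <= C * w y) ->
  (`|kernel_integral k f| <= C%:E * wnorm f)%E.
Proof.
move=> mk mf C0 kC; apply: le_trans (abs_kernel_le mk mf C0 kC).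
by apply: le_abse_integral => //; exact: measurable_kernel_fun.
Qed.

Lemma kernel_integral_add k f g : mu.-integrable D (fun y => (f y * k y)%:E) ->
  mu.-integrable D (fun y => (g y * k y)%:E) ->
  kernel_integral k (fun y => f y + g y) = (kernel_integral k f + kernel_integral k g)%E.
Proof.
move=> intf intg; rewrite /kernel_integral -integralD//.
by apply: eq_integral => y _; rewrite mulrDl EFinD.
Qed.

Lemma kernel_integral_scale a k f : mu.-integrable D (fun y => (f y * k y)%:E) ->
  kernel_integral k (fun y => a * f y) = (a%:E * kernel_integral k f)%E.
Proof.
move=> intf; rewrite /kernel_integral -integralZl//.
by apply: eq_integral => y _; rewrite -EFinM mulrA.
Qed.

Lemma geometric_eseries_le (q : R) n : 0 < q < 1 ->
  (\sum_(j <oo) (q ^+ (n + j))%:E <= (q ^+ n / (1 - q))%:E)%E.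
Proof.
move=> /andP[q0 q1]; apply: lime_le.
  by apply: is_cvg_nneseries => j _ _; rewrite lee_fin exprn_ge0// ltW.
apply: nearW => m; rewrite sumEFin lee_fin.
have := @geometric_le_lim R m (q ^+ n) q (exprn_ge0 _ (ltW q0)) q0.
rewrite gtr0_norm// => /(_ q1); apply: le_trans.
by rewrite /series/= ler_sum// => j _; rewrite exprD.
Qed.

(** The gliding hump: bumps [b j] of unit weighted norm, on which the [j]-th
    kernel is nearly norming, are summed with geometrically small
    coefficients. The signs protect the [i]-th term against the preceding ones,
    the ratio [q] against the following ones. *)
Lemma gliding_hump (k b : nat -> T -> R) (Om : nat -> R) (C c q : R) :
  (forall i, measurable_fun [set: T] (k i)) ->
  (forall i, measurable_fun [set: T] (b i)) ->
  0 < C -> 0 < q < 1 -> C * (q / (1 - q)) <= c / 2 ->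
  (forall i, 0 < Om i) ->
  (forall i y, D y -> `|k i y| <= C * Om i * w y) ->
  (forall i y, 0 <= b i y) -> (forall i, wnorm (b i) = 1%E) ->
  (forall i, ((c * Om i)%:E <= `|kernel_integral (k i) (b i)|)%E) ->
  (forall y, exists n, forall j, (n <= j)%N -> b j y = 0) ->
  exists s : nat -> R, forall f,
    (forall y n, (forall j, (n <= j)%N -> b j y = 0) ->
       f y = \sum_(j < n) s j * (q ^+ j * b j y)) ->
    (wnorm f < +oo)%E /\
    forall i, ((q ^+ i * (c / 2) * Om i)%:E <= `|kernel_integral (k i) f|)%E.
Proof.
move=> mk mb C0 /andP[q0 q1] Cq Om0 kC b0 b1 kb bfin.
have qn (m : nat) : 0 <= q ^+ m by rewrite exprn_ge0// ltW.
have wge0 y := ltW (w0 y).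
have COm i : 0 <= C * Om i by rewrite mulr_ge0 ?ltW.
have mu_ s j : measurable_fun [set: T] (fun y => s * (q ^+ j * b j y)).
  by apply: measurable_funM => //; exact: measurable_funM.
have intb i j : mu.-integrable D (fun y => (b j y * k i y)%:E).
  by apply: (@integrable_kernel _ _ (C * Om i)) => //; [exact: kC|rewrite b1 ltry].
have intu i s j : mu.-integrable D (fun y => (s * (q ^+ j * b j y) * k i y)%:E).
  rewrite (_ : (fun y => _) = fun y => ((s * q ^+ j)%:E * (b j y * k i y)%:E)%E).
    exact: integrableZl.
  by apply/funext => y; rewrite -EFinM !mulrA.
pose a i j := q ^+ j * fine (kernel_integral (k i) (b j)).
have KIb i j : kernel_integral (k i) (b j) = (fine (kernel_integral (k i) (b j)))%:E.
  by rewrite fineK//; apply: integrable_fin_num.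
have [s [s1 sa]] := exists_signs a; exists s => f fE.
pose S n y := \sum_(j < n) s j * (q ^+ j * b j y).
have SS n y : S n.+1 y = S n y + s n * (q ^+ n * b n y) by rewrite /S big_ord_recr.
have mS n : measurable_fun [set: T] (S n) by apply: measurable_sum => j; exact: mu_.
have mf : measurable_fun [set: T] f.
  apply: (measurable_fun_cvg mS) => y _; have [N hN] := bfin y.
  apply: cvg_near_cst; near=> n; apply/esym/fE => j nj; apply: hN.
  by apply: leq_trans nj; near: n; exact: nbhs_infty_ge.
have tail n : (wnorm (fun y => (f y - S n y)%R) <= (q ^+ n / (1 - q))%:E)%E.
  apply: le_trans (@geometric_eseries_le q n _); last by rewrite q0.
  pose g j y : \bar R := ((q ^+ (n + j))%:E * (`|b (n + j)%N y| * w y)%:E)%E.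
  have g0 j y : (0 <= g j y)%E.
    by rewrite mule_ge0// lee_fin// mulr_ge0.
  have mg j : measurable_fun [set: T] (g j).
    by apply: measurable_funeM; exact: measurable_wnorm_fun.
  rewrite (_ : (\sum_(j <oo) _)%E = (\int[mu]_y (\sum_(j <oo) g j y))%E); last first.
    rewrite integral_nneseries//; apply: eq_eseriesr => j _.
    have bw y : setT y -> (0 <= (`|b (n + j)%N y| * w y)%:E)%E.
      by rewrite lee_fin mulr_ge0.
    have mbw := measurable_wnorm_fun (mb (n + j)%N).
    rewrite ge0_integralZl_EFin//.
    by rewrite -[X in (_ * X)%E]/(wnorm (b (n + j)%N)) b1 mule1.
  apply: ge0_le_integral => //.
  - by move=> y _; rewrite lee_fin mulr_ge0// ltW.
  - by apply: measurable_wnorm_fun; exact: measurable_funB.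
  - by apply: (@ge0_emeasurable_sum _ _ _ _ g xpredT) => //.
  move=> y _; have [N hN] := bfin y.
  have -> : f y = S (n + N)%N y.
    by apply: fE => j nj; apply: hN; apply: leq_trans nj; rewrite leq_addl.
  apply: (@le_trans _ _ (\sum_(0 <= j < N) g j y)%E); last first.
    exact: nneseries_lim_ge.
  rewrite /g; under eq_bigr do rewrite -EFinM.
  rewrite sumEFin lee_fin.
  under eq_bigr do rewrite mulrA.
  rewrite -mulr_suml ler_wpM2r ?(ltW (w0 _))//.
  elim: N {hN} => [|N IH]; first by rewrite addn0 subrr normr0 big_geq.
  rewrite addnS SS big_nat_recr//= addrAC; apply: le_trans (ler_normD _ _) _.
  by apply: lerD => //; rewrite !normrM s1 mul1r (@ger0_norm _ (q ^+ _))// exprn_ge0// ltW.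
have S0E : f = fun y => f y - S 0%N y.
  by apply/funext => y; rewrite /S big_ord0 subr0.
split; first by rewrite S0E; apply: le_lt_trans (tail 0%N) _; rewrite ltry.
move=> i.
have intS n : mu.-integrable D (fun y => (S n y * k i y)%:E) /\
    kernel_integral (k i) (S n) = (\sum_(j < n) s j * a i j)%:E.
  elim: n => [|n [IH1 IH2]].
    rewrite /S big_ord0; split.
      rewrite (_ : (fun y => _) = cst 0%E); first exact: integrable0.
      by apply/funext => y; rewrite big_ord0 mul0r.
    by rewrite /kernel_integral integral0_eq// => y _; rewrite big_ord0 mul0r.
  have SE : S n.+1 = fun y => S n y + s n * (q ^+ n * b n y) by apply/funext => y; exact: SS.
  split.
    rewrite SE (_ : (fun y => _) = (fun y => (S n y * k i y)%:E) \+
      (fun y => (s n * (q ^+ n * b n y) * k i y)%:E))%E.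
      exact: integrableD.
    by apply/funext => y; rewrite mulrDl EFinD.
  rewrite SE kernel_integral_add// IH2 big_ord_recr/= EFinD; congr (_ + _)%E.
  rewrite (_ : (fun y => _) = fun y => s n * q ^+ n * b n y); last first.
    by apply/funext => y; rewrite mulrA.
  by rewrite kernel_integral_scale// KIb -EFinM /a mulrA.
have fE2 : f = fun y => S i.+1 y + (f y - S i.+1 y).
  by apply/funext => y; rewrite addrC subrK.
have mT : measurable_fun [set: T] (fun y => f y - S i.+1 y) by exact: measurable_funB.
have intT : mu.-integrable D (fun y => ((f y - S i.+1 y) * k i y)%:E).
  apply: (@integrable_kernel _ _ (C * Om i)) => //; first exact: kC.
  by apply: le_lt_trans (tail _) _; rewrite ltry.
have Tfin : kernel_integral (k i) (fun y => f y - S i.+1 y) \is a fin_num.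
  exact: integrable_fin_num.
have [intSi KISi] := intS i.+1.
rewrite fE2 kernel_integral_add// KISi.
have := kernel_integral_le (mk i) mT (COm i) (kC i).
have := tail i.+1.
rewrite -(fineK Tfin); set t := fine _ => wT tT.
have : (`|t|%:E <= (C * Om i)%:E * (q ^+ i.+1 / (1 - q))%:E)%E.
  by apply: le_trans tT _; rewrite lee_wpmul2l// lee_fin.
rewrite -EFinM lee_fin => tle.
rewrite -EFinD abse_EFin lee_fin.
have aii : q ^+ i * (c * Om i) <= `|a i i|.
  rewrite /a normrM ger0_norm ?exprn_ge0 ?(ltW q0)// ler_wpM2l ?exprn_ge0 ?(ltW q0)//.
  by have := kb i; rewrite KIb abse_EFin lee_fin.
have tq : `|t| <= q ^+ i * (c / 2) * Om i.
  apply: le_trans tle _.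
  rewrite [leLHS](_ : _ = q ^+ i * (C * (q / (1 - q))) * Om i); last by rewrite exprS; ring.
  by rewrite ler_wpM2r ?(ltW (Om0 _))// ler_wpM2l// exprn_ge0// ltW.
have := lerB_normD (\sum_(j < i.+1) s j * a i j) t.
have := sa i; lra.
Unshelve. all: by end_near. Qed.

End weighted_kernel.

Lemma powRN_cvgy0 (R : realType) (s : R) (u : nat -> R) : 0 < s ->
  u n @[n --> \oo] --> +oo -> u n `^ (- s) @[n --> \oo] --> (0 : R).
Proof.
move=> s0 uoo; apply/cvgr0Pnorm_lt => e e0.
have A0 : 0 < e `^ (- s^-1) by rewrite powR_gt0.
near=> n.
have un : e `^ (- s^-1) < u n by near: n; exact: (cvgry_gt uoo).
rewrite ger0_norm ?powR_ge0// powRN -[ltRHS]invrK ltf_pV2 ?posrE ?invr_gt0//.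
  rewrite -[e^-1](_ : (e `^ (- s^-1)) `^ s = _).
    by rewrite gt0_ltr_powR ?nnegrE ?(ltW A0) ?(ltW (lt_trans A0 un)).
  by rewrite -powRrM mulNr mulVf ?gt_eqF// powR_inv1// ltW.
by rewrite powR_gt0// (lt_trans A0).
Unshelve. all: by end_near. Qed.

Section weighted_kernel_decay.
Context d (T : measurableType d) (R : realType) (mu : {measure set T -> \bar R}).
Variables (D : set T) (w : T -> R).
Hypotheses (mD : measurable D) (mw : measurable_fun [set: T] w) (w0 : forall y, 0 < w y).
Implicit Types f g k : T -> R.

(** For [r >= 0] the decay factor is at most 1, and it tends to 0 pointwise:
    dominated convergence. *)
Lemma weighted_decay (h : T -> R) f (s : R) : 0 < s ->
  measurable_fun [set: T] h -> (forall y, D y -> 0 < h y) ->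
  measurable_fun [set: T] f -> (wnorm mu w f < +oo)%E ->
  (\int[mu]_(y in D) (`|f y| * w y * (1 + r * h y) `^ (- s))%:E)%E @[r --> +oo] --> 0%E.
Proof.
move=> s0 mh h0 mf ff; apply/cvge_pinftyP => u uoo.
have mfw := measurable_wnorm_fun mw mf.
have inv1 (a : R) : 0 <= a -> (1 + a) `^ (- s) <= 1.
  move=> a0; rewrite -[leRHS](powRr0 (1 + a)) ler_powR//; first by rewrite lerDl.
  by rewrite oppr_le0 ltW.
pose v n := Num.max 0 (u n).
have vu : \forall n \near \oo, u n = v n.
  near=> n; rewrite /v; apply/esym/max_idPr; near: n; exact: (cvgry_ge uoo).
apply: (@cvg_trans _ ((\int[mu]_(y in D) (`|f y| * w y * (1 + v n * h y) `^ (- s))%:E)%E @[n --> \oo])).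
  by apply: near_eq_cvg; apply: filterS vu => n ->.
have voo : v n @[n --> \oo] --> +oo.
  apply: cvg_trans uoo; apply: near_eq_cvg; apply: filterS vu => n -> //.
have mdec n : measurable_fun D (fun y => (`|f y| * w y * (1 + v n * h y) `^ (- s))%:E).
  apply/measurable_EFinP/measurable_funTS/measurable_funM.
    by apply: measurable_funM => //; exact: measurableT_comp.
  apply: (measurableT_comp (measurable_powR _)); apply: measurable_funD => //.
  exact: measurable_funM.
have [||| _ _] := @dominated_convergence _ _ _ mu D mD
  (fun n y => (`|f y| * w y * (1 + v n * h y) `^ (- s))%:E) (cst 0%E)
  (fun y => (`|f y| * w y)%:E) mdec (measurable_cst _).
- apply: aeW => y Dy.
  rewrite -[X in _ --> X]/(0%:E) -(mulr0 (`|f y| * w y)).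
  apply: cvg_EFin; first exact: nearW.
  apply: cvgMl_tmp; apply: powRN_cvgy0 => //.
  apply/cvgryPge => A; near=> n.
  have h1 : A / h y <= v n by near: n; exact: (cvgry_ge voo).
  by rewrite (le_trans (y := v n * h y)) ?lerDr// -ler_pdivrMr// h0.
- apply/integrableP; split; first exact: measurable_funTS.
  apply: le_lt_trans ff; rewrite /wnorm.
  rewrite (eq_integral (fun y => (`|f y| * w y)%:E)); last first.
    by move=> y _; rewrite gee0_abs// lee_fin mulr_ge0// ltW.
  by apply: ge0_subset_integral => // y _; rewrite lee_fin mulr_ge0// ltW.
- apply: aeW => y n Dy; rewrite gee0_abs; last first.
    by rewrite lee_fin mulr_ge0 ?powR_ge0// mulr_ge0// ltW.
  rewrite lee_fin ler_piMr ?inv1//; first by rewrite mulr_ge0// ltW.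
  by rewrite mulr_ge0 ?(ltW (h0 _ Dy))// le_max lexx.
by rewrite integral0.
Unshelve. all: by end_near. Qed.

Lemma kernel_integral_le_decay (h : T -> R) k f (C r s : R) : 0 <= C ->
  measurable_fun [set: T] k -> measurable_fun [set: T] f -> measurable_fun [set: T] h ->
  (forall y, D y -> `|k y| <= C * w y * (1 + r * h y) `^ (- s)) ->
  (`|kernel_integral mu D k f| <=
   C%:E * \int[mu]_(y in D) (`|f y| * w y * (1 + r * h y) `^ (- s))%:E)%E.
Proof.
move=> C0 mk mf mh kC.
have mfk : measurable_fun D (fun y => (f y * k y)%:E) by exact: measurable_kernel_fun.
have hle := @le_abse_integral _ _ _ mu D _ mD mfk.
apply: (le_trans hle).
have mg : measurable_fun D (fun y => (`|f y| * w y * (1 + r * h y) `^ (- s))%:E).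
  apply/measurable_EFinP/measurable_funTS/measurable_funM.
    by apply: measurable_funM => //; exact: measurableT_comp.
  apply: (measurableT_comp (measurable_powR _)); apply: measurable_funD => //.
  exact: measurable_funM.
have g0 y : D y -> (0 <= (`|f y| * w y * (1 + r * h y) `^ (- s))%:E)%E.
  by rewrite lee_fin mulr_ge0 ?powR_ge0// mulr_ge0// ltW.
rewrite -ge0_integralZl_EFin//; apply: ge0_le_integral => //.
- by apply: measurableT_comp => //; exact: measurable_kernel_fun.
- exact: measurable_funeM.
- move=> y Dy; rewrite /= -EFinM lee_fin normrM.
  rewrite [leRHS](_ : _ = `|f y| * (C * w y * (1 + r * h y) `^ (- s))); last by ring.
  by rewrite ler_wpM2l// kC.
Qed.

Lemma wnorm_scale (a : R) f : 0 <= a -> measurable_fun [set: T] f ->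
  wnorm mu w (fun y => a * f y) = (a%:E * wnorm mu w f)%E.
Proof.
move=> a0 mf; rewrite /wnorm -ge0_integralZl_EFin//.
- by apply: eq_integral => y _; rewrite normrM (ger0_norm a0) -EFinM mulrA.
- by move=> y _; rewrite lee_fin mulr_ge0// ltW.
- exact: measurable_wnorm_fun.
Qed.

Lemma wnorm_bump (A : set T) f (m : R) : measurable A -> (0 < mu A < +oo)%E ->
  measurable_fun [set: T] f -> (forall y, w y <= 1) ->
  (forall y, A y -> 0 < f y <= m) -> (forall y, ~ A y -> f y = 0) ->
  exists2 c : R, 0 < c & wnorm mu w f = c%:E.
Proof.
move=> mA /andP[A0 Aoo] mf w1 fA fA0.
have mfw := measurable_wnorm_fun mw mf.
have fw0 y : (0 <= (`|f y| * w y)%:E)%E by rewrite lee_fin mulr_ge0// ltW.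
have ffin : (wnorm mu w f < +oo)%E.
  apply: (@le_lt_trans _ _ (\int[mu]_y (m * \1_A y)%:E)%E).
    apply: ge0_le_integral => //.
    - by apply/measurable_EFinP; apply: measurable_funM => //; exact: measurable_indic.
    - move=> y _; rewrite lee_fin indicE.
      have [Ay|nAy] := pselect (A y).
        rewrite mem_set// mulr1; have /andP[f0 fm] := fA y Ay.
        by rewrite gtr0_norm// (le_trans _ fm)// ler_piMr// ltW.
      by rewrite memNset// mulr0 fA0// normr0 mul0r.
  rewrite (@integralZl_indic _ _ _ _ _ _ (fun=> A))// ?integral_indic ?setIT//.
    by rewrite -(@fineK _ (mu A)) ?gt0_fin_numE// -EFinM ltry.
  by move=> m0; apply/seteqP; split=> // y Ay; have := fA y Ay; lra.
have fpos : (0 < wnorm mu w f)%E.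
  rewrite lt_def (integral_ge0 _ (fun y _ => fw0 y)) andbT; apply/eqP => f0.
  have [+ _] := @ae_eq_integral_abs _ _ _ mu _ measurableT _ mfw.
  have -> : (\int[mu]_y `|(`|f y| * w y)%:E| = 0)%E.
    by rewrite -f0; apply: eq_integral => y _; rewrite gee0_abs.
  move=> /(_ erefl) [N [mN N0 AN]].
  have : (mu A <= mu N)%E.
    apply: le_measure; rewrite ?inE// => y Ay; apply: AN => /= /(_ I) [] /eqP.
    by rewrite mulf_eq0 normr_eq0 !gt_eqF//; have /andP[] := fA y Ay.
  by rewrite N0 leNgt A0.
exists (fine (wnorm mu w f)); first by rewrite fine_gt0// fpos.
by rewrite fineK// gt0_fin_numE.
Qed.

End weighted_kernel_decay.

(** On the support of the bump [b] the kernel has the constant sign [e], so there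
    is no cancellation. *)
Lemma kernel_integral_bump d (T : measurableType d) (R : realType)
    (mu : {measure set T -> \bar R}) (D : set T) (w k b : T -> R) (C e : R) :
  measurable D -> measurable_fun [set: T] w -> (forall y, 0 < w y) ->
  measurable_fun [set: T] k -> measurable_fun [set: T] b ->
  mu.-integrable D (fun y => (b y * k y)%:E) ->
  0 <= C -> `|e| = 1 -> (forall y, 0 <= b y) ->
  (forall y, b y != 0 -> D y /\ C * w y <= e * k y) ->
  (C%:E * wnorm mu w b <= `|kernel_integral mu D k b|)%E.
Proof.
move=> mD mw w0 mk mb ik C0 e1 b0 bk.
have mbw := measurable_wnorm_fun mw mb.
have bw0 y : (0 <= (`|b y| * w y)%:E)%E by rewrite lee_fin mulr_ge0// ltW.
have -> : (`|kernel_integral mu D k b| = `|kernel_integral mu D k (fun y => (e * b y)%R)|)%E.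
  by rewrite kernel_integral_scale// abseM abse_EFin e1 mul1e.
have -> : wnorm mu w b = (\int[mu]_(y in D) (`|b y| * w y)%:E)%E.
  rewrite /wnorm [RHS]integral_mkcond; apply: eq_integral => y _.
  rewrite patchE; case: ifPn => // /negP; rewrite inE => nDy.
  have [->|/bk[]//] := eqVneq (b y) 0; by rewrite normr0 mul0r.
have mbwD : measurable_fun D (fun y => (`|b y| * w y)%:E) by exact: measurable_funTS.
rewrite -ge0_integralZl_EFin//.
apply: le_trans (lee_abs _); apply: ge0_le_integral => //.
- by move=> y Dy; rewrite mule_ge0.
- exact: measurable_funeM.
- by apply: measurable_kernel_fun => //; exact: measurable_funM.
move=> y Dy; rewrite -EFinM lee_fin ger0_norm// mulrCA [e * _]mulrC -mulrA.
have [->|/bk[_ h]] := eqVneq (b y) 0; first by rewrite !mul0r.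
by rewrite ler_wpM2l.
Qed.

(** * Continuity of the kernel, and bumps *)

Section continuity.
Context {R : realType}.

Lemma powR_continuous (s a : R) : 0 < a -> {for a, continuous (fun x : R => x `^ s)}.
Proof.
move=> a0; apply/differentiable_continuous/derivable1_diffP.
by apply: derivable_powR; rewrite in_itv/= a0.
Qed.

Lemma dotr_continuous d (u : 'rV[R]_d) : continuous (dot u).
Proof.
apply: continuous_big => [|i _ v]; last first.
  have c : v' 0 i @[v' --> v] --> v 0 i := @coord_continuous R 1 d 0 i v.
  exact: (cvgMl_tmp c).
exact: add_continuous.
Qed.

Lemma enorm_powR_cvg d (s : R) (y0 : 'rV[R]_d) : 0 < enorm y0 ->
  enorm y `^ s @[y --> y0] --> enorm y0 `^ s.
Proof.
move=> y00; have ce : enorm y @[y --> y0] --> enorm y0 := @enorm_continuous R d y0.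
have h : z `^ s @[z --> enorm y0] --> enorm y0 `^ s := @powR_continuous s _ y00.
by apply: cvg_comp ce h.
Qed.

Lemma KM_continuous (l : R) M d (x : 'rV[R]_d.+1) (y0 : 'rV[R]_d) :
  half_space x -> 0 < enorm y0 -> {for y0, continuous (KM l M x)}.
Proof.
move=> hx y00.
have ce : enorm y @[y --> y0] --> enorm y0 := @enorm_continuous R d y0.
have cd : dot (Defs.proj x) y @[y --> y0] --> dot (Defs.proj x) y0 :=
  @dotr_continuous d (Defs.proj x) y0.
have cp s := @enorm_powR_cvg d s y0 y00.
pose q y := enorm y ^+ 2 - 2 * dot (Defs.proj x) y + enorm x ^+ 2.
have cq : q y @[y --> y0] --> q y0.
  exact: (cvgD (cvgB (cvgM ce ce) (cvgMl_tmp cd)) (cvg_cst _)).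
have q0 : 0 < q y0 by rewrite /q -dist_sqrE ltr_wpDl ?sqr_ge0// exprn_gt0.
have cqp : q y `^ (- l) @[y --> y0] --> q y0 `^ (- l).
  have h : z `^ (- l) @[z --> q y0] --> q y0 `^ (- l) := @powR_continuous (- l) _ q0.
  by apply: cvg_comp cq h.
pose t y := dot (Defs.proj x) y * ((enorm x)^-1 * enorm y `^ (-1)).
have ct : t y @[y --> y0] --> t y0 by exact: (cvgM cd (cvgMl_tmp (cp _))).
have cg (m : nat) : (gegenbauer l m).[t y] @[y --> y0] --> (gegenbauer l m).[t y0].
  have h : (gegenbauer l m).[z] @[z --> t y0] --> (gegenbauer l m).[t y0] :=
    @continuous_horner R (gegenbauer l m) (t y0).
  by apply: cvg_comp ct h.
rewrite /prop_for /continuous_at KM_explicit//; apply: (cvgB cqp).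
apply: cvg_big => [|m _]; first exact: add_continuous.
exact: (cvgM (cvgMl_tmp (cp _)) (cg m)).
Qed.

(** A product of one-dimensional tents, supported in a ball of the maximum
    norm: such balls are boxes, whose Lebesgue measure is known. *)
Definition box_bump d (y0 : 'rV[R]_d) (e : R) (y : 'rV[R]_d) : R :=
  \prod_(i < d) Num.max 0 (e - `|y0 0 i - y 0 i|).

Lemma box_bump_continuous d (y0 : 'rV[R]_d) e : continuous (box_bump y0 e).
Proof.
apply: continuous_big => [|i _ v]; first exact: mul_continuous.
have c : v' 0 i @[v' --> v] --> v 0 i := @coord_continuous R 1 d 0 i v.
have ch : {for v, continuous (fun v' : 'rV[R]_d => e - `|y0 0 i - v' 0 i| : R^o)}.
  exact: (cvgB (cvg_cst _) (cvg_norm (cvgB (cvg_cst _) c))).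
have c0 : {for v, continuous (cst 0 : 'rV[R]_d -> R^o)}.
  by apply: (@cst_continuous 'rV[R]_d R^o 0).
exact: (continuous_max c0 ch).
Qed.

Lemma measurable_box_bump d (y0 : 'rV[R]_d) e :
  measurable_fun [set: 'rV[R]_d] (box_bump y0 e).
Proof.
apply: measurable_prod => i _; apply: measurable_maxr => //.
apply: measurable_funB => //; apply: measurableT_comp => //.
by apply: measurable_funB => //; exact: measurable_coord.
Qed.

Lemma box_bump_ge0 d (y0 : 'rV[R]_d) e y : 0 <= box_bump y0 e y.
Proof. by apply: prodr_ge0 => i _; rewrite le_max lexx. Qed.

Definition box d (y0 : 'rV[R]_d) (e : R) : set 'rV[R]_d :=
  [set y | forall i, ball (y0 0 i) e (y 0 i)].

Lemma box_bump_box d (y0 : 'rV[R]_d) e y : 0 < e -> box y0 e y ->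
  0 < box_bump y0 e y <= e ^+ d.
Proof.
move=> e0 yb; apply/andP; split.
  by apply: prodr_gt0 => i _; rewrite lt_max subr_gt0 (yb i) orbT.
have -> : e ^+ d = \prod_(i < d) e by rewrite prodr_const card_ord.
apply: ler_prod => i _.
by rewrite le_max lexx/= ge_max (ltW e0)/= lerBlDr lerDl.
Qed.

Lemma box_bump_out d (y0 : 'rV[R]_d) e y : ~ box y0 e y -> box_bump y0 e y = 0.
Proof.
move=> /existsNP[i /negP]; rewrite -leNgt => yi.
rewrite /box_bump (bigD1 i)//= (_ : Num.max _ _ = 0) ?mul0r//.
by apply/max_idPl; rewrite subr_le0.
Qed.

Lemma measurable_box d (y0 : 'rV[R]_d) e : measurable (box y0 e).
Proof.
rewrite (_ : box y0 e = \bigcap_(i in [set: 'I_d]) [set y | ball (y0 0 i) e (y 0 i)]).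
  apply: fin_bigcap_measurable => // i _.
  rewrite -[X in measurable X]setTI; apply: measurable_coord => //.
  exact: measurable_ball.
by apply/seteqP; split=> y /= h i; [move=> _; exact: h|exact: h].
Qed.

Lemma lebesgue_box d (y0 : 'rV[R]_d) e : 0 < e ->
  (0 < lebesgue_rV d (box y0 e) < +oo)%E.
Proof.
move=> e0; rewrite lebesgue_rV_borel; last exact: measurable_box.
rewrite (borel_lebesgue_rV_box (fun i => measurable_ball (y0 0 i) e)).
under eq_bigr do rewrite (lebesgue_measure_ball _ (ltW e0)).
by rewrite prodEFin ltry lte_fin prodr_gt0// => i _; rewrite mulrn_wgt0.
Qed.

End continuity.

(** * The estimate, and the humps *)

Section half_space_operator.
Context {R : realType}.
Variables (l : R) (M d : nat).
Hypothesis l0 : 0 < l.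
Implicit Types (x : 'rV[R]_d.+1) (y : 'rV[R]_d).
Let s := Num.min 1 (2 * l).
Let leb : {measure set (lebesgue_type R d) -> \bar R} := @lebesgue_rV R d.
Let W : lebesgue_type R d -> R := @weight R l M d.
Let Kx (x : 'rV[R]_d.+1) : lebesgue_type R d -> R := KM l M x.
Let inv_norm : lebesgue_type R d -> R := fun y => @enorm R d y `^ (-1).

(** The measure-theoretic lemmas above are stated for abstract measures and
    kernels; this identifies [F] with an instance of them. *)
Lemma F_kernel_integral (f : 'rV[R]_d -> R) x :
  F l M f x = kernel_integral leb (@far R d) (Kx x) f.
Proof. by []. Qed.

Lemma growth_integrableE (f : 'rV[R]_d -> R) :
  growth_integrable l M f = (wnorm leb W f < +oo)%E.
Proof. by []. Qed.

Let W0 y : 0 < W y. Proof. exact: weight_gt0. Qed.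

Let mKx x : half_space x -> measurable_fun [set: lebesgue_type R d] (Kx x).
Proof. by move=> hx; exact: (measurable_fun_lebesgue (measurable_KM l M hx)). Qed.

Let mW : measurable_fun [set: lebesgue_type R d] W.
Proof. exact: measurable_weight. Qed.

Let m_inv_norm : measurable_fun [set: lebesgue_type R d] inv_norm.
Proof. exact: (measurable_fun_lebesgue (measurable_enorm_powR (-1))). Qed.

Let mfar : measurable (@far R d). Proof. exact: measurable_far. Qed.

Let s0 : 0 < s. Proof. by rewrite /s lt_min ltr01 mulr_gt0. Qed.

Let inv_norm_gt0 y : @far R d y -> 0 < inv_norm y.
Proof. by move=> y1; apply: powR_gt0; apply: lt_trans y1. Qed.

Lemma F_little_o (f : 'rV[R]_d -> R) :
  measurable_fun [set: lebesgue_type R d] (f : lebesgue_type R d -> R) ->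
  growth_integrable l M f -> little_o (F l M f) (omega l M).
Proof.
move=> mf; rewrite growth_integrableE => ff.
have [C C0 hC] := @KM_le_weight R l M d l0.
pose H r := (\int[leb]_(y in @far R d) (`|f y| * W y * (1 + r * inv_norm y) `^ (- s))%:E)%E.
have H0 : (C%:E * H r)%E @[r --> +oo] --> 0%E.
  rewrite -[X in _ --> X](mule0 C%:E); apply: cvgeZl => //.
  exact: (weighted_decay mfar mW W0 s0 m_inv_norm inv_norm_gt0 mf ff).
have FH x : half_space x -> (`|F l M f x| <= (C * omega l M x)%:E * H (enorm x))%E.
  move=> hx; rewrite F_kernel_integral.
  have Cw : 0 <= C * omega l M x by rewrite mulr_ge0 ?(ltW C0) ?(ltW (omega_gt0 M l0 hx)).
  have kC y : @far R d y ->
      `|Kx x y| <= C * omega l M x * W y * (1 + enorm x * inv_norm y) `^ (- s).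
    by move=> y1; have := hC x y hx y1; rewrite /ratio /inv_norm powR_inv1 ?enorm_ge0.
  exact: (@kernel_integral_le_decay _ _ _ leb _ _ mfar mW W0 _ _ _ _ _ _ Cw
    (mKx hx) mf m_inv_norm kC).
rewrite /little_o.
apply: (squeeze_cvge _ (cvg_cst 0%E) H0).
near=> r; have r0 : 0 < r by near: r; exact: nbhs_pinfty_gt.
apply/andP; split.
  pose x : 'rV[R]_d.+1 := r *: delta_mx 0 ord_max.
  have hx : half_space x by rewrite /half_space/= !mxE !eqxx mulr1.
  have xr : enorm x = r.
    rewrite enormZ ?(ltW r0)// /enorm /dot (bigD1 ord_max)//=
      big1 ?addr0 ?mxE ?eqxx ?mulr1 ?sqrtr1 ?mulr1//.
    by move=> i /negPf i0; rewrite mxE eqxx i0 mulr0.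
  apply: (@le_trans _ _ (`|F l M f x| * ((omega l M x)^-1)%:E)%E).
    by rewrite mule_ge0// lee_fin invr_ge0 ltW// omega_gt0.
  by apply: ereal_sup_ubound; exists x.
apply: ge_ereal_sup => _ [x [hx xr] <-].
have w0 := omega_gt0 M l0 hx.
rewrite -xr lee_pdivrMr//.
by rewrite muleAC -EFinM; exact: FH.
Unshelve. all: by end_near. Qed.

Lemma Kx_le : exists2 C : R, 0 < C & forall x y, half_space x -> @far R d y ->
  `|Kx x y| <= C * omega l M x * W y.
Proof.
have [C C0 hC] := @KM_le_weight R l M d l0; exists C => // x y hx y1.
have x0 := half_space_enorm hx.
apply: le_trans (hC x y hx y1) _; rewrite ler_piMr//.
  apply: mulr_ge0; last exact: (ltW (W0 y)).
  by apply: mulr_ge0; apply: ltW => //; exact: omega_gt0.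
have r0 : 0 <= ratio x y by rewrite /ratio divr_ge0 ?enorm_ge0.
rewrite -[leRHS](powRr0 (1 + ratio x y)) ler_powR ?lerDl//.
by rewrite oppr_le0 ltW.
Qed.

(** By continuity the lower bound [KM_ge] persists, with half the constant, in a
    neighbourhood of the point that it provides; a normalized bump in that
    neighbourhood is nearly norming for the kernel at [x]. *)
Lemma F_hump : (0 < d)%N -> exists2 c : R, 0 < c & forall x, half_space x ->
  2 < enorm x -> exists b : 'rV[R]_d -> R,
  [/\ continuous b, measurable_fun [set: lebesgue_type R d] (b : lebesgue_type R d -> R),
      forall y, 0 <= b y & forall y, enorm y <= enorm x / 4 -> b y = 0] /\
  (wnorm leb W b = 1%E /\
   ((c * omega l M x)%:E <= `|kernel_integral leb (@far R d) (Kx x) b|)%E).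
Proof.
move=> d0; have [c c0 hc] := @KM_ge R l M d l0 d0.
exists (c / 2) => [|x hx x2]; first by rewrite divr_gt0.
have [y0 [y01 xy0 ky0]] := hc x hx x2.
have w0 := omega_gt0 M l0 hx.
pose e : R := if 0 <= KM l M x y0 then 1 else -1.
have e1 : `|e| = 1 by rewrite /e; case: ifP; rewrite ?normrN normr1.
have eK : e * KM l M x y0 = `|KM l M x y0|.
  by rewrite /e; case: ltP => h; rewrite ?mul1r ?mulN1r ?(ltr0_norm h) ?(ger0_norm h).
have y00 : 0 < enorm y0 by lra.
have cn : enorm y @[y --> y0] --> enorm y0 := @enorm_continuous R d y0.
have cw : @weight R l M d y @[y --> y0] --> @weight R l M d y0.
  have wp0 : enorm y0 `^ (M%:R + 2 * l) + 1 != 0.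
    by rewrite gt_eqF// ltr_wpDl ?powR_ge0.
  have cp := @enorm_powR_cvg R d (M%:R + 2 * l) y0 y00.
  have cp1 : enorm y `^ (M%:R + 2 * l) + 1 @[y --> y0] --> enorm y0 `^ (M%:R + 2 * l) + 1.
    exact: (cvgD cp (cvg_cst _)).
  exact: (cvgV wp0 cp1).
have cK : (e * KM l M x y) @[y --> y0] --> e * KM l M x y0.
  exact: (cvgMl_tmp (@KM_continuous R l M d x y0 hx y00)).
have nearby : \forall y \near y0, [/\ 1 < enorm y, enorm x / 4 < enorm y &
    c / 2 * omega l M x * @weight R l M d y <= e * KM l M x y].
  have gap : 0 < e * KM l M x y0 - c / 2 * omega l M x * @weight R l M d y0.
    have Ww := weight_gt0 l M y0.
    have h : c * omega l M x * weight l M y0 <= `|KM l M x y0|.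
      apply: le_trans ky0; apply: ler_wpM2l; last exact: weight_le.
      by rewrite mulr_ge0// ltW.
    have : 0 < c * omega l M x * weight l M y0.
      by apply: mulr_gt0 => //; exact: mulr_gt0.
    rewrite eK; lra.
  have cgap : e * KM l M x y - c / 2 * omega l M x * weight l M y @[y --> y0] -->
      e * KM l M x y0 - c / 2 * omega l M x * weight l M y0.
    exact: (cvgB cK (@cvgMl_tmp _ _ _ _ _ (c / 2 * omega l M x) _ cw)).
  near=> y; split.
  - by near: y; exact: (cvgr_gt _ cn).
  - by near: y; apply: (cvgr_gt _ cn); lra.
  - rewrite -subr_ge0; apply: ltW; near: y; exact: (cvgr_gt _ cgap _ gap).
have [r r0 hr] : exists2 r, 0 < r & forall y, box y0 r y ->
    [/\ 1 < enorm y, enorm x / 4 < enorm y &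
    c / 2 * omega l M x * @weight R l M d y <= e * KM l M x y].
  move/nbhs_ballP : nearby => [r /= r0 hr]; exists r => // y yr; apply: hr.
  by split=> // i j; rewrite (ord1 i); exact: yr.
pose B := box_bump y0 r.
have mB : measurable_fun [set: lebesgue_type R d] (B : lebesgue_type R d -> R).
  exact: (measurable_fun_lebesgue (measurable_box_bump y0 r)).
have W1 y : W y <= 1.
  by rewrite /W /weight invf_le1 ?lerDr ?powR_ge0// ltr_wpDl ?powR_ge0.
have [a a0 Ba] := wnorm_bump mW W0 (measurable_lebesgue (measurable_box y0 r))
   (lebesgue_box y0 r0) mB W1
   (fun y yb => box_bump_box r0 yb) (fun y yb => box_bump_out yb).
exists (fun y => a^-1 * B y).
have ai0 : 0 <= a^-1 by rewrite invr_ge0 ltW.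
have mb : measurable_fun [set: lebesgue_type R d] (fun y : lebesgue_type R d => a^-1 * B y).
  by apply: measurable_funM => //; exact: measurable_cst.
have b0 y : 0 <= a^-1 * B y by rewrite mulr_ge0// box_bump_ge0.
have bnorm : wnorm leb W (fun y => a^-1 * B y) = 1%E.
  by rewrite (@wnorm_scale _ _ _ leb W mW W0 _ _ ai0 mB) Ba -EFinM mulVf// gt_eqF.
split.
  split => //.
    by move=> y; exact: (cvgMl_tmp (@box_bump_continuous R d y0 r y)).
  move=> y yx; rewrite /B box_bump_out ?mulr0// => /hr[_ h _].
  by move: yx; rewrite leNgt h.
split => //.
rewrite -[X in (X <= _)%E]mule1 -bnorm.
have [C C0 hC] := Kx_le.
have Cw : 0 <= C * omega l M x by apply: mulr_ge0; exact: ltW.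
have cw0 : 0 <= c / 2 * omega l M x.
  by apply: mulr_ge0; [rewrite divr_ge0// ltW|exact: ltW].
have bfin : (wnorm leb W (fun y => (a^-1 * B y)%R) < +oo)%E by rewrite bnorm ltry.
have int_b := @integrable_kernel _ _ _ leb _ W mfar mW W0 (Kx x) _ _ (mKx hx) mb Cw
  (fun y => hC x y hx) bfin.
apply: (@kernel_integral_bump _ _ _ leb _ W (Kx x) _ _ e mfar mW W0 (mKx hx) mb
  int_b cw0 e1 b0).
move=> y; rewrite mulf_eq0 negb_or => /andP[_ By].
have yb : box y0 r y by apply: contrapT => /box_bump_out yb; rewrite /B yb eqxx in By.
by have [? _ ?] := hr y yb.
Unshelve. all: by end_near. Qed.

End half_space_operator.

(** * Sharpness *)

Lemma little_o_near (R : realType) d (g w : 'rV[R]_d.+1 -> R) (e : R) :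
  (forall x, half_space x -> 0 < w x) -> 0 < e -> little_o (EFin \o g) w ->
  exists r : R, forall x, half_space x -> r < enorm x -> g x <= e * w x.
Proof.
move=> w0 e0 gw.
have : \forall r \near +oo%R, (ereal_sup [set (`|(EFin \o g) x| * ((w x)^-1)%:E)%E | x in
    [set x | half_space x /\ enorm x = r]] < e%:E)%E.
  have e0' : (0 < e%:E)%E by rewrite lte_fin.
  exact: (gw _ (open_ereal_lt' e0')).
move=> [r [_ hr]]; exists r => x hx rx.
have := hr _ rx; move/ltW => h.
have : (`|(EFin \o g) x| * ((w x)^-1)%:E <= e%:E)%E.
  by apply: le_trans h; apply: ereal_sup_ubound; exists x.
rewrite /= -EFinM lee_fin ler_pdivrMr ?w0//; apply: le_trans; exact: ler_norm.
Qed.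

(** A series whose terms vanish identically on larger and larger balls is
    locally a finite sum. *)
Lemma locally_finite_series (R : realType) d (u : nat -> 'rV[R]_d -> R) :
  (forall j, continuous (u j)) ->
  (forall j y, enorm y <= j.+1%:R -> u j y = 0) ->
  exists f : 'rV[R]_d -> R, continuous f /\
    forall y n, (forall j, (n <= j)%N -> u j y = 0) -> f y = \sum_(j < n) u j y.
Proof.
move=> cu u0; pose f y := limn (fun n => \sum_(j < n) u j y).
have fE y n : (forall j, (n <= j)%N -> u j y = 0) -> f y = \sum_(j < n) u j y.
  move=> un; apply: cvg_lim => //; apply: cvg_near_cst; near=> m.
  have nm : (n <= m)%N by near: m; exact: nbhs_infty_ge.
  rewrite -!(big_mkord xpredT (fun j => u j y)) (@big_cat_nat _ _ _ n 0 m)//=.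
  rewrite [X in _ + X]big1_seq ?addr0// => j /andP[_].
  by rewrite mem_index_iota => /andP[nj _]; exact: un.
exists f; split => // y0.
pose N := (Num.truncn (enorm y0)).+1.
have y0N : enorm y0 < N%:R by rewrite /N truncnS_gt.
have ce : enorm y @[y --> y0] --> enorm y0 := @enorm_continuous R d y0.
have fN y : enorm y < N%:R -> f y = \sum_(j < N) u j y.
  move=> yN; apply: fE => j Nj; apply: u0; apply: (le_trans (ltW yN)).
  by rewrite ler_nat (leq_trans Nj).
have cS : continuous (fun y => \sum_(j < N) u j y).
  by apply: continuous_big => [|j _]; [exact: add_continuous|exact: cu].
have nb : \forall y \near y0, enorm y < N%:R by exact: (cvgr_lt _ ce).
have eqf : {near nbhs y0, (fun y => \sum_(j < N) u j y) =1 f}.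
  by apply: filterS nb => y yN; exact/esym/fN.
have h : f @ y0 --> \sum_(j < N) u j y0 := cvg_trans (near_eq_cvg eqf) (cS y0).
rewrite -(fN _ y0N) in h; exact: h.
Unshelve. all: by end_near. Qed.

(** Points [x (n j)] of the sequence are selected on which [psi] is at most
    [q ^ j * (c / 2) * omega], which is what the gliding hump guarantees for [F].
    The requirement [4 * (j + 1) <= |x (n j)|] pushes the bumps to infinity, so
    that their sum is locally finite and continuous. *)
Lemma F_sharp (R : realType) (l : R) (M d : nat) : 0 < l -> (0 < d)%N ->
  forall psi : 'rV[R]_d.+1 -> R, (forall x, half_space x -> 0 < psi x) ->
  little_o (EFin \o psi) (omega l M) ->
  forall x : nat -> 'rV[R]_d.+1, (forall i, half_space (x i)) ->
  enorm (x i) @[i --> \oo] --> +oo%R ->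
  exists f : 'rV[R]_d -> R, [/\ continuous f, growth_integrable l M f &
    ~ ((F l M f (x i) * ((psi (x i))^-1)%:E)%E @[i --> \oo] --> 0%E)].
Proof.
move=> l0 d0 psi psi0 psio x hx xoo.
have [C C0 hC] := @Kx_le R l M d l0.
have [c c0 hc] := @F_hump R l M d l0 d0.
(* The largest ratio for which the tail of the geometric series, weighted by the
   upper bound [C], costs at most half of the lower bound [c]. *)
pose q := c / (2 * C + c).
have D0 : 0 < 2 * C + c by lra.
have q0 : 0 < q by rewrite divr_gt0.
have q1 : q < 1 by rewrite /q ltr_pdivrMr//; lra.
have Cq : C * (q / (1 - q)) <= c / 2.
  rewrite le_eqVlt; apply/orP; left; apply/eqP; rewrite /q; field.
  by rewrite !gt_eqF//; lra.
have w0 i := omega_gt0 M l0 (hx i).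
have sub k : exists i, [/\ (k <= i)%N, 2 < enorm (x i), 4 * k.+1%:R <= enorm (x i) &
    psi (x i) <= q ^+ k * (c / 2) * omega l M (x i)].
  have e0 : 0 < q ^+ k * (c / 2) by rewrite mulr_gt0 ?exprn_gt0//; lra.
  have [r hr] := little_o_near (@omega_gt0 R l M d l0) e0 psio.
  near \oo => i; exists i; split.
  - by near: i; exact: nbhs_infty_ge.
  - by near: i; exact: (cvgry_gt xoo).
  - by near: i; exact: (cvgry_ge xoo).
  - by apply: hr => //; near: i; exact: (cvgry_gt xoo).
have [n hn] := choice sub.
have hump k := hc (x (n k)) (hx _) (let: And4 _ h _ _ := hn k in h).
have [b hb] := choice hump.
have bvanish j y : enorm y <= j.+1%:R -> b j y = 0.
  move=> yj; have [[_ _ _ bz] _] := hb j; apply: bz; have [_ _ h _] := hn j; lra.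
have bfin y : exists N, forall j, (N <= j)%N -> b j y = 0.
  exists (Num.truncn (enorm y)).+1 => j Nj; apply: bvanish.
  apply: (le_trans (ltW (truncnS_gt _))); rewrite ler_nat; exact: leqW.
pose k i : lebesgue_type R d -> R := KM l M (x (n i)).
have [s hs] := @gliding_hump _ (lebesgue_type R d) R (@lebesgue_rV R d) (@far R d)
  (@weight R l M d) (@measurable_far R d) (@measurable_weight R l M d) (@weight_gt0 R l M d)
  k b (fun i => omega l M (x (n i))) C c q
  (fun i => measurable_fun_lebesgue (measurable_KM l M (hx (n i))))
  (fun i => let: conj (And4 _ h _ _) _ := hb i in h) C0 (introT andP (conj q0 q1)) Cq
  (fun i => w0 (n i)) (fun i y => hC (x (n i)) y (hx (n i)))
  (fun i => let: conj (And4 _ _ h _) _ := hb i in h)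
  (fun i => let: conj _ (conj h _) := hb i in h)
  (fun i => let: conj _ (conj _ h) := hb i in h) bfin.
have cu j : continuous (fun y => s j * (q ^+ j * b j y)).
  move=> y; have [[cb _ _ _] _] := hb j.
  exact: (cvgMl_tmp (cvgMl_tmp (cb y))).
have uz j y : enorm y <= j.+1%:R -> s j * (q ^+ j * b j y) = 0.
  by move=> /bvanish ->; rewrite !mulr0.
have [f [cf fE]] := locally_finite_series cu uz.
have [ff Ff] := hs f (fun y N h => fE y N (fun j Nj =>
  etrans (congr1 (fun z => s j * (q ^+ j * z)) (h j Nj))
    (etrans (congr1 _ (mulr0 _)) (mulr0 _)))).
exists f; split => //.
move=> Fpsi.
have F1 : \forall i \near \oo, (`|F l M f (x i) * ((psi (x i))^-1)%:E| < 1%:E)%E.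
  have l01 : (0 < 1%:E :> \bar R)%E by rewrite lte_fin.
  exact: ((cvg_abse0P _).2 Fpsi _ (open_ereal_lt' l01)).
have [N _ hN] := F1.
have [Nn _ _ hpsi] := hn N.
have := hN _ Nn; apply/negP; rewrite -leNgt.
have p0 := psi0 _ (hx (n N)).
rewrite abseM abse_EFin gtr0_norm ?invr_gt0// lee_pdivlMr// mul1e.
apply: le_trans (Ff N); by rewrite lee_fin.
Unshelve. all: by end_near. Qed.

Unset Implicit Arguments.

Theorem theorem2p1 (R : realType) (d : nat) (hd : (1 <= d)%N)
    (lambda : R) (hlambda : 0 < lambda) (M : nat) :
  (forall f : 'rV[R]_d -> R,
     measurable_fun [set: lebesgue_type R d] (f : lebesgue_type R d -> R) ->
     growth_integrable lambda M f ->
     little_o (F lambda M f) (omega lambda M)) /\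
  (forall psi : 'rV[R]_d.+1 -> R,
     (forall x, half_space x -> 0 < psi x) ->
     little_o (EFin \o psi) (omega lambda M) ->
     forall x : nat -> 'rV[R]_d.+1,
       (forall i, half_space (x i)) ->
       enorm (x i) @[i --> \oo] --> +oo%R ->
       exists f : 'rV[R]_d -> R,
         [/\ continuous f,
             growth_integrable lambda M f &
             ~ ((F lambda M f (x i) * ((psi (x i))^-1)%:E)%E
                  @[i --> \oo] --> 0%E)]).
Proof.
split=> [f mf ff|psi psi0 psio x hx xoo]; first exact: F_little_o.
exact: F_sharp.
Qed.
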